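(* Let $d\ge1$ be an integer and $0<s<1$. Let $f\in L^1(\mathbb{R}^d)$ be compactly supported. Then $f\in W^{s,1}_c(\mathbb{R}^d)$ if and only if $$\sup\left\{\int_{\mathbb{R}^d} f\operatorname{div}v: v\in C^1(\mathbb{R}^d;\mathbb{R}^d)\text{ and }\operatorname{Lip}^{1-s}v\le1\right\}<\infty .$$
   Context: $\operatorname{Lip}^{1-s}v=\sup_{x\ne y}|v(x)-v(y)|/|x-y|^{1-s}$ is the $(1-s)$-Hölder constant of $v$. $W^{s,1}_c(\mathbb{R}^d)$ is the space of compactly supported functions $f\in L^1(\mathbb{R}^d)$ with $\int_{\mathbb{R}^d}\int_{\mathbb{R}^d}\frac{|f(x)-f(y)|}{|x-y|^{d+s}}\,dx\,dy<\infty$. *)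

(* Defs.v *)
From HB Require Import structures.
From mathcomp Require Import all_boot all_order all_algebra.
From mathcomp Require Import all_classical all_reals all_analysis.

Set Implicit Arguments.
Unset Strict Implicit.
Unset Printing Implicit Defensive.

Import Order.TTheory GRing.Theory Num.Theory.
Import numFieldNormedType.Exports.

Local Open Scope classical_set_scope.
Local Open Scope ring_scope.

(* 'rV[T]_n carries the product sigma-algebra, generated by the coordinates,
   exactly as the library does for n.-tuple T. For T = R (Borel sets) this is
   the Borel sigma-algebra of R^n. *)
Definition measure_rV_display : measure_display -> measure_display.
Proof. exact. Qed.

Section measurable_rV.
Context {d} {T : sigmaRingType d}.
Variable n : nat.

Let coors : 'I_n -> 'rV[T]_n -> T := fun i x => x ord0 i.

Let rV_set0 : g_sigma_preimage coors set0.
Proof. exact: sigma_algebra0. Qed.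

Let rV_setC A : g_sigma_preimage coors A -> g_sigma_preimage coors (~` A).
Proof. exact: sigma_algebraC. Qed.

Let rV_bigcup (F : _^nat) : (forall i, g_sigma_preimage coors (F i)) ->
  g_sigma_preimage coors (\bigcup_i (F i)).
Proof. exact: sigma_algebra_bigcup. Qed.

HB.instance Definition _ := @isMeasurable.Build (measure_rV_display d)
  'rV[T]_n (g_sigma_preimage coors) rV_set0 rV_setC rV_bigcup.

End measurable_rV.

Section measurable_coord.
Context {d} {T : measurableType d}.

Lemma measurable_coord n (i : 'I_n) :
  measurable_fun [set: 'rV[T]_n] (fun x : 'rV[T]_n => x ord0 i).
Proof.
move=> _ Y mY; rewrite setTI; apply: sub_sigma_algebra => /=.
rewrite -bigcup_seq/=; exists i => /=; first by rewrite mem_index_enum.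
by exists Y => //; rewrite setTI.
Qed.

Lemma measurable_fun_rV d' (S : measurableType d') n (f : S -> 'rV[T]_n) :
  (forall i, measurable_fun [set: S] (fun x => f x ord0 i)) ->
  measurable_fun [set: S] f.
Proof.
move=> mf; apply: (@measurability _ _ _ _ _ _
  (\big[setU/set0]_(i < n) preimage_set_system setT
     (fun x : 'rV[T]_n => x ord0 i) measurable)) => //.
move=> _ [A + <-]; rewrite -bigcup_seq => -[i _ [B mB <-]].
by rewrite !setTI; have := mf i measurableT B mB; rewrite setTI.
Qed.

End measurable_coord.

Section lebesgue_rV_succ.
Context {R : realType} (n : nat).
Variable mu : {sigma_finite_measure set 'rV[R]_n -> \bar R}.

Definition cons_rV (p : measurableTypeR R * 'rV[R]_n) : 'rV[R]_n.+1 :=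
  \row_i oapp (p.2 ord0) p.1 (unlift ord0 i).

Lemma measurable_cons_rV : measurable_fun setT cons_rV.
Proof.
apply: measurable_fun_rV => i; under eq_fun do rewrite mxE.
case: (unliftP ord0 i) => [j _|_].
  apply: (@measurableT_comp _ _ _ _ _ _ (fun x : 'rV[R]_n => x ord0 j) _ snd).
    exact: measurable_coord.
  exact: measurable_snd.
exact: (@measurable_fst _ _ (measurableTypeR R) 'rV[R]_n).
Qed.

Definition lebesgue_rV_succ : set 'rV[R]_n.+1 -> \bar R :=
  pushforward (lebesgue_measure \x mu)%E cons_rV.

Let succ0 : lebesgue_rV_succ set0 = 0%E.
Proof. by rewrite /lebesgue_rV_succ measure0//; exact: measurable_cons_rV. Qed.

Let succ_ge0 A : (0 <= lebesgue_rV_succ A)%E.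
Proof. by apply: measure_ge0; exact: measurable_cons_rV. Qed.

Let succ_sigma_additive : semi_sigma_additive lebesgue_rV_succ.
Proof.
by apply: measure_semi_sigma_additive; exact: measurable_cons_rV.
Qed.

HB.instance Definition _ := isMeasure.Build _ _ _ lebesgue_rV_succ
  succ0 succ_ge0 succ_sigma_additive.

Lemma lebesgue_rV_succE (A : set (measurableTypeR R)) (B : set 'rV[R]_n) :
  measurable A -> measurable B ->
  lebesgue_rV_succ [set x | A (x ord0 ord0) /\ B (\row_i x ord0 (lift ord0 i))]
  = (lebesgue_measure A * mu B)%E.
Proof.
move=> mA mB; rewrite -(product_measure1E lebesgue_measure mu mA mB).
rewrite /lebesgue_rV_succ /pushforward; congr product_measure1.
apply/seteqP; split => -[x y] /=; rewrite !mxE unlift_none/=;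
  rewrite (_ : (\row_i _) = y)//; apply/rowP => i; by rewrite !mxE liftK.
Qed.

Let measurable_behead_rV :
  measurable_fun setT (fun x : 'rV[R]_n.+1 => \row_i x ord0 (lift ord0 i)).
Proof.
apply: measurable_fun_rV => i; under eq_fun do rewrite mxE.
exact: measurable_coord.
Qed.

Let succ_sigma_finite : sigma_finite setT lebesgue_rV_succ.
Proof.
have /sigma_finiteP[F [TF ndF Foo]] := sigma_finiteT (@lebesgue_measure R).
have /sigma_finiteP[G [TG ndG Goo]] := sigma_finiteT mu.
exists (fun k => [set x : 'rV[R]_n.+1 | F k (x ord0 ord0) /\
                               G k (\row_i x ord0 (lift ord0 i))]).
  apply/esym; rewrite -subTset => x _.
  have [k _ Fk] : (\bigcup_k F k) (x ord0 ord0) by rewrite -TF.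
  have [l _ Gl] : (\bigcup_k G k) (\row_i x ord0 (lift ord0 i)) by rewrite -TG.
  exists (maxn k l) => //; split.
    by move: Fk; exact/subsetPset/ndF/leq_maxl.
  by move: Gl; exact/subsetPset/ndG/leq_maxr.
move=> k; have [mF Fk] := Foo k; have [mG Gk] := Goo k; split.
  apply: measurableI.
    rewrite -[X in measurable X]setTI.
    exact: (measurable_coord (T := R) ord0 measurableT mF).
  rewrite -[X in measurable X]setTI.
  exact: measurable_behead_rV measurableT _ mG.
by rewrite lebesgue_rV_succE// lte_mul_pinfty// ge0_fin_numE.
Qed.

HB.instance Definition _ := Measure_isSigmaFinite.Build _ _ _ lebesgue_rV_succ
  succ_sigma_finite.

End lebesgue_rV_succ.

(* Lebesgue measure on R^n, built as the iterated product of the library's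
   Lebesgue measure on R, through (t, y) |-> (t, y_0, ..., y_(n-1)). *)
Fixpoint lebesgue_rV (R : realType) (n : nat) :
    {sigma_finite_measure set 'rV[R]_n -> \bar R} :=
  match n with
  | 0 => dirac (0 : 'rV[R]_0)
  | k.+1 => lebesgue_rV_succ (lebesgue_rV R k)
  end.

(* Sanity check: together with sigma-finiteness, the value on boxes
   characterizes Lebesgue measure on the Borel sets. *)
Lemma lebesgue_rV_box (R : realType) (n : nat) (A : 'I_n -> set R) :
  (forall i, measurable (A i)) ->
  lebesgue_rV R n [set x | forall i, A i (x ord0 i)] =
  (\prod_(i < n) lebesgue_measure (A i))%E.
Proof.
elim: n A => [|n IHn] A mA.
  by rewrite big_ord0 /= diracE mem_set//= => -[].
have mB : measurable
    [set y : 'rV[R]_n | forall i, A (lift ord0 i) (y ord0 i)].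
  rewrite (_ : mkset _ = \bigcap_(i in [set: 'I_n])
    ([set: 'rV[R]_n] `&` (fun y : 'rV[R]_n => y ord0 i) @^-1` A (lift ord0 i))).
    by apply: fin_bigcap_measurable => // i _; apply: measurable_coord.
  apply/seteqP; split => y Hy i; first by split => //; exact: Hy.
  by case: (Hy i).
rewrite big_ord_recl -IHn// -(lebesgue_rV_succE (lebesgue_rV R n) (mA ord0))//.
congr (_ _); apply/seteqP; split => x /=.
  by move=> Ax; split => // i; rewrite mxE.
move=> [A0 Ax] i; case: (unliftP ord0 i) => [j ->|-> //].
by have := Ax j; rewrite mxE.
Qed.

Section fractional_sobolev.
Context {R : realType}.

(* The norm that 'rV[R]_n carries in the library is the sup norm. *)
Definition enorm n (x : 'rV[R]_n) : R :=
  Num.sqrt (\sum_(i < n) x ord0 i ^+ 2).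

(* As an element of L^1, f is only defined up to null sets. *)
Definition compactly_supported d (f : 'rV[R]_d -> R) : Prop :=
  exists2 K : set 'rV[R]_d, compact K &
    {ae lebesgue_rV R d, forall x, ~ K x -> f x = 0}.

(* On the diagonal the integrand is 0 / 0 = 0. *)
Definition Ws1_seminorm d (s : R) (f : 'rV[R]_d -> R) : \bar R :=
  (\int[lebesgue_rV R d]_y \int[lebesgue_rV R d]_x
     (`|f x - f y| / enorm (x - y) `^ (d%:R + s))%:E)%E.

Definition Ws1c d (s : R) (f : 'rV[R]_d -> R) : Prop :=
  [/\ (lebesgue_rV R d).-integrable [set: 'rV[R]_d] (EFin \o f),
      compactly_supported f &
      (Ws1_seminorm s f < +oo)%E].

Definition holder_const d (a : R) (v : 'rV[R]_d -> 'rV[R]_d) : \bar R :=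
  ereal_sup [set (enorm (v z.1 - v z.2) / enorm (z.1 - z.2) `^ a)%:E
            | z in [set z : 'rV[R]_d * 'rV[R]_d | z.1 <> z.2]].

Definition C1 d (v : 'rV[R]_d -> 'rV[R]_d) : Prop :=
  (forall x, differentiable v x) /\ continuous (fun x => 'J v x).

Definition divergence d (v : 'rV[R]_d -> 'rV[R]_d) (x : 'rV[R]_d) : R :=
  \sum_(i < d) 'D_(delta_mx ord0 i) (fun y => v y ord0 i) x.

End fractional_sobolev.

(* Main.v *)
(** Write [g h] for the [L^1] norm of [f (. + h) - f]. By translation invariance
and Tonelli the seminorm is [\int g h / |h|^(d+s) dh], and since [g] is
subadditive and even it is finite if and only if the sums
[\sum_k 2^(ks) g (t_k e_i)], [|t_k| <= 2^-k], are bounded for each axis [i].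

If they are, put [q_k := 2^k (v_i (. + 2^-k e_i) - v_i)]. Then [|q_k| <= 2^(ks)]
by the Hoelder bound on [v], [q_k] tends to [d_i v_i], and
[q_k - q_(k+1) = 1/2 (q_(k+1) (. + 2^-(k+1) e_i) - q_(k+1))], so telescoping
moves the difference onto [f] and bounds [\int f d_i v_i].

Conversely choose [sigma_k] Lipschitz, [|sigma_k| <= 1], nearly norming
[f (. + t_k e_i) - f], so that [g (t_k e_i)] is comparable to the integral of
[f] against [D_k P sigma_k], where [D_k] is a difference of step [- t_k e_i] and
[P] an average over a small cube. Write [P] as the average over a cube of side
[2^-k] plus successive halvings of the side. Along each axis
[A_(2c) = 1/2 (A_c + A_c (. + c e_j))] for the segment averages [A_c], and a
difference of step [c e_j] is [c d_j A_c]; hence the part of [D_k P sigma_k] at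
scale [2^-m] is the divergence of a [C^1] field of size [2^-m] and of bounded
Lipschitz constant. Summed with the weights [2^(ks)], these fields add up to one
whose [(1 - s)]-Hoelder constant does not depend on the number of terms. *)

From HB Require Import structures.
Require Import Defs.
From mathcomp Require Import all_boot all_order all_algebra.
From mathcomp Require Import all_classical all_reals all_analysis.
From mathcomp Require Import measurable_realfun ring lra.
Import Order.TTheory GRing.Theory Num.Theory.
Import numFieldNormedType.Exports.
Local Open Scope classical_set_scope.
Local Open Scope ring_scope.

Set Implicit Arguments.
Unset Strict Implicit.
Unset Printing Implicit Defensive.

(** * Lebesgue measure on row vectors *)

Section translation.
Context {R : realType}.

(** The functions [sigma_k] come from a density argument, so nothing is known about their Lipschitz
    constants. Only [|sigma_k| <= 1] may enter the estimates, yet [P] must be fine enough, depending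
    on [sigma_k], to move it very little. This is why [P] is split over scales: all bounds on the
    fields are independent of the finest scale. A piece of scale [2^-m] has a modulus of continuity
    of order [min(2^-m, rho)], and the sum over [k] of [2^(ks)] times the sum over [m >= k] of these
    minima is of order [rho^(1-s)]: [s > 0] bounds the sum over [k <= m] by a multiple of its last
    term, and [s < 1] makes the remaining series in [m] converge. Segment averages replace a
    mollifier because the derivative of such an average along its own axis is a difference quotient,
    with an explicit remainder. The steps [t_k] stay free in [[-2^-k, 2^-k]]: they are finally
    placed where [g (t e_i)] is within a factor 2 of its supremum, so that one value controls [g] on
    a whole shell. Compact support keeps the derivatives of [v] bounded where [f] lives, as the
    limit of the [q_k] under the integral requires. *)

Lemma lebesgue_measureD (t : R) (A : set R) : measurable A ->
  lebesgue_measure ((fun x => x + t) @^-1` A) = lebesgue_measure A.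
Proof.
move=> mA.
have mt : measurable_fun [set: measurableTypeR R]
    (fun x : R => x + t : measurableTypeR R) by exact: measurable_funD.
pose phi : {mfun measurableTypeR R >-> measurableTypeR R} :=
  @mfun_Sub _ _ (measurableTypeR R) (measurableTypeR R) _ (mem_set mt).
rewrite -[LHS]/(pushforward lebesgue_measure phi A).
apply/esym/lebesgue_measure_unique => //= _ [[a b]] _ <-.
rewrite /pushforward /= (_ : _ @^-1` _ = `]a - t, b - t]%classic); last first.
  by apply/seteqP; split => x /=; rewrite !in_itv/= ltrBlDr lerBrDr.
rewrite !lebesgue_measure_itv/= !lte_fin ltrD2r -!EFinB.
by case: ifP => // _; congr (_%:E); ring.
Qed.

Lemma ge0_integral_shiftR (t : R) (f : R -> \bar R) :
  measurable_fun [set: R] f -> (forall x, 0 <= f x)%E ->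
  (\int[lebesgue_measure]_x f (x + t)%R = \int[lebesgue_measure]_x f x)%E.
Proof.
move=> mf f0.
have mt : measurable_fun [set: measurableTypeR R]
    (fun x : R => x + t : measurableTypeR R) by exact: measurable_funD.
pose phi : {mfun measurableTypeR R >-> measurableTypeR R} :=
  @mfun_Sub _ _ (measurableTypeR R) (measurableTypeR R) _ (mem_set mt).
transitivity (\int[pushforward lebesgue_measure phi]_(x in setT) f x)%E.
  by rewrite ge0_integral_pushforward.
by apply: eq_measure_integral => //= A mA AS; exact: lebesgue_measureD.
Qed.

Lemma measurable_addrV n (h : 'rV[R]_n) :
  measurable_fun [set: 'rV[R]_n] (fun x => x + h).
Proof.
apply: measurable_fun_rV => i; under eq_fun do rewrite mxE.
apply: measurable_funD; [exact: measurable_coord|exact: measurable_cst].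
Qed.

Lemma lebesgue_rVD n (h : 'rV[R]_n) (A : set 'rV[R]_n) : measurable A ->
  lebesgue_rV R n ((fun x => x + h) @^-1` A) = lebesgue_rV R n A.
Proof.
elim: n h A => [|n IHn] h A mA.
  by congr (lebesgue_rV R 0 _); apply/seteqP; split => x; rewrite /= (thinmx0 h) addr0.
pose h' : 'rV[R]_n := \row_i h ord0 (lift ord0 i).
pose F (t : R) := lebesgue_rV R n [set y | A (cons_rV (t, y))].
have mcA : measurable (@cons_rV R n @^-1` A).
  by rewrite -[X in measurable X]setTI; exact: measurable_cons_rV.
have FE t : F t = lebesgue_rV R n (xsection (@cons_rV R n @^-1` A) t).
  by congr (lebesgue_rV R n _); apply/seteqP; split => y /=; rewrite /xsection/= inE.
rewrite /= /lebesgue_rV_succ /pushforward /= /product_measure1.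
(* On each slice the induction hypothesis absorbs [h'], the coordinates of [h] other than the first;
   what is left is a shift of the first coordinate, handled on the line. *)
transitivity (\int[lebesgue_measure]_t F (t + h ord0 ord0)%R)%E.
  apply: eq_integral => t _; rewrite /F -(IHn h'); last first.
    rewrite (_ : mkset _ = xsection (@cons_rV R n @^-1` A) (t + h ord0 ord0)); last first.
      by apply/seteqP; split => y /=; rewrite /xsection/= inE.
    exact: measurable_xsection.
  congr (lebesgue_rV R n _); apply/seteqP; split => y /=; rewrite /xsection/= inE/=;
    set a := (X in A X); set b := (X in _ -> A X); suff -> : a = b by [];
    apply/rowP => i; rewrite !mxE; case: unliftP => [j|] -> //=; by rewrite !mxE.
rewrite ge0_integral_shiftR//.
  by apply: eq_integral => t _; rewrite FE.
rewrite (_ : F = lebesgue_rV R n \o xsection (@cons_rV R n @^-1` A)).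
  exact: measurable_fun_xsection.
by apply/funext => t; rewrite FE.
Qed.

Lemma ge0_integral_shift_rV n (h : 'rV[R]_n) (f : 'rV[R]_n -> \bar R) :
  measurable_fun setT f -> (forall x, 0 <= f x)%E ->
  (\int[lebesgue_rV R n]_x f (x + h)%R = \int[lebesgue_rV R n]_x f x)%E.
Proof.
move=> mf f0.
pose phi : {mfun 'rV[R]_n >-> 'rV[R]_n} := mfun_Sub (mem_set (measurable_addrV h)).
transitivity (\int[pushforward (lebesgue_rV R n) phi]_(x in setT) f x)%E.
  by rewrite ge0_integral_pushforward.
by apply: eq_measure_integral => //= A mA AS; exact: lebesgue_rVD.
Qed.

End translation.

(** * Sup norm, Euclidean norm and Borel sets *)

Section rV_norm.
Context {R : realType} {n : nat}.
Implicit Types x : 'rV[R]_n.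

Lemma coord_le_norm x i : `|x ord0 i| <= `|x|.
Proof.
rewrite [leRHS]/Num.norm /= mx_normrE; apply/bigmax_geP; right => /=.
by exists (ord0, i).
Qed.

Lemma rV_norm_le x (r : R) : 0 <= r -> (`|x| <= r) = [forall i, `|x ord0 i| <= r].
Proof.
move=> r0; apply/idP/forallP => [xr i|xr].
  exact: le_trans (coord_le_norm x i) xr.
rewrite [leLHS]/Num.norm /= mx_normrE; apply/bigmax_leP; split => //= -[j i] _ /=.
by rewrite (ord1 j).
Qed.

Lemma rV_norm_lt x (r : R) : 0 < r -> (`|x| < r) = [forall i, `|x ord0 i| < r].
Proof.
move=> r0; apply/idP/forallP => [xr i|xr].
  exact: le_lt_trans (coord_le_norm x i) xr.
rewrite [ltLHS]/Num.norm /= mx_normrE; apply/bigmax_ltP; split => //= -[j i] _ /=.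
by rewrite (ord1 j).
Qed.

Lemma enorm_ge0 x : 0 <= enorm x. Proof. exact: sqrtr_ge0. Qed.

Lemma norm_le_enorm x : `|x| <= enorm x.
Proof.
rewrite rV_norm_le ?enorm_ge0//; apply/forallP => i.
rewrite -sqrtr_sqr ler_wsqrtr// (bigD1 i)//= lerDl.
by apply: sumr_ge0 => j _; exact: sqr_ge0.
Qed.

Lemma enorm_le_norm x : enorm x <= n%:R * `|x|.
Proof.
have h : \sum_(i < n) x ord0 i ^+ 2 <= (n%:R * `|x|) ^+ 2.
  apply: (@le_trans _ _ (n%:R * `|x| ^+ 2)).
    rewrite mulr_natl -[X in _ *+ X]card_ord -sumr_const ler_sum// => i _.
    by rewrite -real_normK ?num_real// lerXn2r ?nnegrE// coord_le_norm.
  rewrite exprMn ler_wpM2r ?sqr_ge0// -natrX ler_nat.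
  by case: (n) => // k; rewrite expnS leq_pmulr// expn_gt0.
apply: (le_trans (ler_wsqrtr h)).
by rewrite sqrtr_sqr ger0_norm// mulr_ge0.
Qed.

Lemma enorm0 : enorm (0 : 'rV[R]_n) = 0.
Proof.
by rewrite /enorm big1 ?sqrtr0// => i _; rewrite mxE expr0n.
Qed.

Lemma enorm_gt0 x : x != 0 -> 0 < enorm x.
Proof. by move=> x0; apply: lt_le_trans (norm_le_enorm x); rewrite normr_gt0. Qed.

End rV_norm.

Section continuous_measurable.
Context {R : realType} {n : nat}.

(** The sigma-algebra is generated by the coordinates, so an open set has to be exhausted by
    countably many boxes: those with rational centre and radius that it contains. *)
Lemma open_measurable_rV (U : set 'rV[R]_n) : open U -> measurable U.
Proof.
move=> oU.
pose B (cr : 'rV[rat]_n * rat) := [set x : 'rV[R]_n |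
  forall i, `|x ord0 i - ratr (cr.1 ord0 i)| < ratr cr.2].
have mB cr : measurable (B cr).
  rewrite /B (_ : mkset _ = \bigcap_(i in [set: 'I_n])
      ([set: 'rV[R]_n] `&` (fun x : 'rV[R]_n => x ord0 i) @^-1`
        `]ratr (cr.1 ord0 i) - ratr cr.2, ratr (cr.1 ord0 i) + ratr cr.2[)).
    by apply: fin_bigcap_measurable => // i _; exact: measurable_coord.
  apply/seteqP; split => x /= h i.
    by move=> _; split => //; rewrite /= in_itv/= -ltr_distl; exact: h.
  by have [_] := h i Logic.I; rewrite /= in_itv/= -ltr_distl.
have -> : U = \bigcup_cr (if `[< B cr `<=` U >] then B cr else set0).
  apply/seteqP; split => [x Ux|x [cr _]]; last by case: asboolP => // BU /BU.
  (* A rational radius below [e / 2] suffices: two points of one box then differ by less than [e] in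
     each coordinate. *)
  have /(@nbhs_ballP R) [e /= e0 xeU] : nbhs x U by exact: open_nbhs_nbhs.
  have /rat_in_itvoo[r] : 0 < e / 2 by lra.
  rewrite in_itv/= => /andP[r0 re].
  have /choice[c cE] : forall i, exists c : rat,
      ratr c \in `]x ord0 i - ratr r, x ord0 i + ratr r[.
    by move=> i; apply: rat_in_itvoo; lra.
  exists (\row_i c i, r) => //.
  have xB : B (\row_i c i, r) x.
    move=> i /=; rewrite mxE; have := cE i; rewrite in_itv/= ltr_norml.
    by move=> /andP[? ?]; apply/andP; split; lra.
  case: asboolP => // BU; exfalso; apply: BU => y yB; apply: xeU.
  rewrite -ball_normE/= rV_norm_lt//; apply/forallP => i; rewrite !mxE.
  have := xB i; have := yB i; rewrite /= mxE.
  by rewrite !ltr_norml => /andP[? ?] /andP[? ?]; apply/andP; split; lra.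
apply: countable_bigcupT_measurable => // cr.
by case: asboolP.
Qed.

Lemma continuous_measurable_fun_rV (f : 'rV[R]_n -> R) :
  continuous f -> measurable_fun setT f.
Proof.
move=> /continuousP cf; apply: (measurability _ (RGenOpens.measurableE R)).
move=> _ [_ [a [b ->] <-]]; rewrite setTI; apply: open_measurable_rV.
exact/cf/interval_open.
Qed.

End continuous_measurable.

(** * Pairings of an integrable function with bounded functions *)

Section pairing.
Context {disp : measure_display} {T : measurableType disp} {R : realType}.
Variable mu : {measure set T -> \bar R}.
Implicit Types phi u : T -> R.

Lemma integrable_EFinD phi u : mu.-integrable setT (EFin \o phi) ->
  mu.-integrable setT (EFin \o u) ->
  mu.-integrable setT (EFin \o (fun x => phi x + u x)).
Proof. by move=> iphi iu; exact: (integrableD measurableT iphi iu). Qed.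

Lemma integrable_EFinZl phi (a : R) : mu.-integrable setT (EFin \o phi) ->
  mu.-integrable setT (EFin \o (fun x => a * phi x)).
Proof. by move=> iphi; exact: (integrableZl measurableT a iphi). Qed.

Lemma integrable_EFinB phi u : mu.-integrable setT (EFin \o phi) ->
  mu.-integrable setT (EFin \o u) ->
  mu.-integrable setT (EFin \o (fun x => phi x - u x)).
Proof. by move=> iphi iu; exact: (integrableB measurableT iphi iu). Qed.

(** The bound is asked only where [phi] does not vanish, because the multiplier will be a partial
    derivative of a [C^1] field, which is bounded on the compact set carrying [f]. The sign of [B]
    is not known, hence [|B|] in the proof. *)
Lemma integrable_mulr_bounded phi u (B : R) :
  mu.-integrable setT (EFin \o phi) -> measurable_fun setT u ->
  {ae mu, forall x, phi x != 0 -> `|u x| <= B} ->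
  mu.-integrable setT (EFin \o (fun x => phi x * u x)).
Proof.
move=> iphi mu_ uB.
have mphi : measurable_fun setT phi.
  by apply/measurable_EFinP; exact: measurable_int iphi.
have mpu : measurable_fun setT (EFin \o (fun x => phi x * u x)).
  by apply/measurable_EFinP; exact: measurable_funM.
apply/integrableP; split => //.
have [_ foo] := integrableP _ _ _ iphi.
apply: (@le_lt_trans _ _ (\int[mu]_x ((`|B|)%:E * `|(phi x)%:E|))%E).
  apply: ae_ge0_le_integral => //.
  - exact: measurableT_comp.
  - by apply: measurable_funeM; exact/measurableT_comp/measurable_EFinP.
  apply: filterS uB => x uB _ /=; rewrite normrM mulrC -EFinM lee_fin.
  have [->|/uB ?] := eqVneq (phi x) 0; first by rewrite normr0 !mulr0.
  by rewrite ler_wpM2r// (le_trans _ (ler_norm B)).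
rewrite ge0_integralZl//; last exact/measurableT_comp/measurable_EFinP.
by rewrite lte_mul_pinfty.
Qed.

Lemma Rintegral_mulr_cvg phi (u_ : nat -> T -> R) u (B : R) :
  mu.-integrable setT (EFin \o phi) ->
  (forall k, measurable_fun setT (u_ k)) -> measurable_fun setT u ->
  {ae mu, forall x, phi x != 0 -> forall k, `|u_ k x| <= B} ->
  {ae mu, forall x, phi x != 0 -> u_ k x @[k --> \oo] --> u x} ->
  \int[mu]_x (phi x * u_ k x) @[k --> \oo] --> \int[mu]_x (phi x * u x).
Proof.
move=> iphi mu_ mu0 uB ucv.
have mphi : measurable_fun setT phi.
  by apply/measurable_EFinP; exact: measurable_int iphi.
have [] := @dominated_convergence _ T R mu setT measurableT
  (fun k => EFin \o (fun x => phi x * u_ k x)) (EFin \o (fun x => phi x * u x))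
  (fun x => (`|B|)%:E * `|(phi x)%:E|)%E.
- by move=> k; apply/measurable_EFinP; exact: measurable_funM.
- by apply/measurable_EFinP; exact: measurable_funM.
- apply: filterS ucv => x ucv _; apply: cvg_EFin; first by near=> k.
  have [phix0|/ucv ucvx] := eqVneq (phi x) 0; last exact: cvgMr.
  rewrite [in X in _ --> X]phix0 mul0r (_ : _ \o _ = cst 0); first exact: cvg_cst.
  by apply/funext => k /=; rewrite phix0 mul0r.
- by apply: integrableZl => //; exact: integrable_abse iphi.
- apply: filterS uB => x uB k _ /=; rewrite normrM mulrC -EFinM lee_fin.
  have [->|/uB ?] := eqVneq (phi x) 0; first by rewrite normr0 !mulr0.
  by rewrite ler_wpM2r// (le_trans _ (ler_norm B)).
move=> ifu _; rewrite -[X in _ --> X]fineK; last exact: integrable_fin_num.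
by move=> /fine_cvgP[_].
Unshelve. all: by end_near. Qed.

Lemma ler_norm_Rintegral_mulr phi u (B : R) :
  mu.-integrable setT (EFin \o phi) -> measurable_fun setT u ->
  (forall x, `|u x| <= B) ->
  `|\int[mu]_x (phi x * u x)| <= B * \int[mu]_x `|phi x|.
Proof.
move=> iphi mu_ uB.
have iu : mu.-integrable setT (EFin \o (fun x => phi x * u x)).
  by apply: (@integrable_mulr_bounded _ _ B) => //; apply: aeW => x _.
have iphi' : mu.-integrable setT (EFin \o (fun x => `|phi x|)).
  exact: integrable_abse iphi.
apply: (le_trans (le_normr_Rintegral _ _)) => //.
rewrite -RintegralZl//; apply: le_Rintegral => //.
- exact: integrable_abse iu.
- exact: (integrableZl _ _ iphi').
- by move=> x _; rewrite normrM mulrC ler_wpM2r.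
Qed.

End pairing.

Lemma norm_lipschitz_continuous {R : realType} (V W : normedModType R) (K : R)
  (u : V -> W) : (forall x y, `|u x - u y| <= K * `|x - y|) -> continuous u.
Proof.
move=> uK x; apply/cvgrPdist_lt => e e0.
have K0 : 0 < `|K| + 1 by rewrite ltr_wpDl.
have eK : 0 < (`|K| + 1)^-1 * e by rewrite mulr_gt0// invr_gt0.
near=> y; apply: (le_lt_trans (uK x y)).
apply: (@le_lt_trans _ _ ((`|K| + 1) * `|x - y|)).
  by rewrite ler_wpM2r// (le_trans (ler_norm K))// lerDl.
by rewrite -ltr_pdivlMl//; near: y; exact: cvgr_dist_lt.
Unshelve. all: by end_near. Qed.

Definition klipschitz {R : realType} {V : normedModType R} (K : R) (u : V -> R) :=
  forall x y, `|u x - u y| <= K * `|x - y|.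

Lemma klipschitz_continuous {R : realType} (V : normedModType R) (K : R) (u : V -> R) :
  klipschitz K u -> continuous u.
Proof. exact: norm_lipschitz_continuous. Qed.

Lemma klipschitz_measurable {R : realType} n (K : R) (u : 'rV[R]_n -> R) :
  klipschitz K u -> measurable_fun setT u.
Proof. by move=> /klipschitz_continuous/continuous_measurable_fun_rV. Qed.

(** * Approximation by Lipschitz functions in weighted L^1 *)

Section lipschitz_density.
Context {R : realType} {n : nat}.
Variable mu : {measure set 'rV[R]_n -> \bar R}.
Variable phi : 'rV[R]_n -> R.
Hypothesis iphi : mu.-integrable setT (EFin \o phi).

(** Membership in the closure of the [[0, 1]]-valued Lipschitz functions for the [L^1] distance of
    the finite measure [|phi| mu]. *)
Definition lip_approx (w : 'rV[R]_n -> R) := measurable_fun setT w /\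
  (forall x, 0 <= w x <= 1) /\
  forall e, 0 < e -> exists c, [/\ exists K, klipschitz K c,
    forall x, 0 <= c x <= 1 & \int[mu]_x (`|phi x| * `|w x - c x|) <= e].

Let iphi' : mu.-integrable setT (EFin \o (fun x => `|phi x|)).
Proof. exact: integrable_abse iphi. Qed.

Let diff_bound (a b : R) : 0 <= a <= 1 -> 0 <= b <= 1 -> `| `|a - b| | <= 1.
Proof.
by move=> /andP[? ?] /andP[? ?]; rewrite normr_id ler_norml; apply/andP; lra.
Qed.

Let integrable_diff (w c : 'rV[R]_n -> R) : measurable_fun setT w -> measurable_fun
    setT c ->
  (forall x, 0 <= w x <= 1) -> (forall x, 0 <= c x <= 1) ->
  mu.-integrable setT (EFin \o (fun x => `|phi x| * `|w x - c x|)).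
Proof.
move=> mw mc w01 c01; apply: (@integrable_mulr_bounded _ _ _ _ _ _ 1) => //.
  by apply: measurableT_comp => //; exact: measurable_funB.
by apply: aeW => x _; exact: diff_bound.
Qed.

Lemma lip_approx_klipschitz K c : klipschitz K c -> (forall x, 0 <= c x <= 1) ->
    lip_approx c.
Proof.
move=> cK c01; split; first exact: klipschitz_measurable cK.
split => // e e0; exists c; split => //; first by exists K.
rewrite (_ : (fun x => _) = cst 0) ?Rintegral_cst ?mul0r ?ltW//.
by apply/funext => x; rewrite subrr normr0 mulr0.
Qed.

(** Dominated convergence with majorant [|phi|] replaces [w] by some [w_ k], whose own approximant
    then serves. For indicators this is the passage from finite to countable unions. *)
Lemma lip_approx_cvg (w_ : nat -> 'rV[R]_n -> R) w :
  (forall k, lip_approx (w_ k)) -> (forall x, w_ k x @[k --> \oo] --> w x) ->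
  lip_approx w.
Proof.
move=> aw wcv; have w01 x : 0 <= w x <= 1.
  have cvx := wcv x; rewrite -(cvg_lim _ cvx)//; apply/andP; split.
    by apply: limr_ge; [apply: cvgP cvx|apply: nearW => k; case: (aw k) => _ [/(_
        x)/andP[]]].
  by apply: limr_le; [apply: cvgP cvx|apply: nearW => k; case: (aw k) => _ [/(_
      x)/andP[]]].
have mw : measurable_fun setT w.
  by apply: (@measurable_fun_cvg _ _ _ _ w_) => // k; case: (aw k).
split => //; split => // e e0.
have : \int[mu]_x (`|phi x| * `|w x - w_ k x|) @[k --> \oo] -->
       \int[mu]_x (`|phi x| * (cst 0 x)).
  apply: (@Rintegral_mulr_cvg _ _ _ _ _ _ _ 1) => //.
  - move=> k; apply: measurableT_comp => //; apply: measurable_funB => //.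
    by case: (aw k).
  - by apply: aeW => x _ k; apply: diff_bound => //; case: (aw k) => _ [].
  - apply: aeW => x _.
    have wx : w x - w_ k x @[k --> \oo] --> w x - w x.
      by apply: cvgB; [exact: cvg_cst|exact: wcv].
    by have /= := cvg_norm wx; rewrite subrr normr0; apply.
rewrite (_ : (fun x => `|phi x| * cst 0 x) = cst 0); last first.
  by apply/funext => x /=; rewrite mulr0.
rewrite Rintegral_cst// mul0r => /cvgr_lt/(_ (e / 2)).
case => [|k _ /(_ k (leqnn k)) hk]; first by rewrite divr_gt0.
have [mwk [wk01 /(_ (e / 2))[|c [[K cK] c01 hc]]]] := aw k; first by rewrite divr_gt0.
exists c; split => //; first by exists K.
have mc := klipschitz_measurable cK.
apply: (@le_trans _ _ (\int[mu]_x (`|phi x| * `|w x - w_ k x| + `|phi x| * `|w_ k x -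
    c x|))).
  apply: le_Rintegral => //; [exact: integrable_diff| |].
    by apply: integrable_EFinD; exact: integrable_diff.
  move=> x _; rewrite -mulrDr ler_wpM2l//.
  by rewrite (le_trans _ (ler_normD _ _))// addrA subrK.
rewrite RintegralD//; [|exact: integrable_diff..].
by rewrite [leRHS](splitr e) lerD// ltW.
Qed.

Lemma lip_approx_max w1 w2 : lip_approx w1 -> lip_approx w2 ->
  lip_approx (fun x => Num.max (w1 x) (w2 x)).
Proof.
have max01 (a b : R) : 0 <= a <= 1 -> 0 <= b <= 1 -> 0 <= Num.max a b <= 1.
  by move=> /andP[a0 a1] /andP[b0 b1]; rewrite le_max a0 ge_max a1 b1.
have maxB (a b c d : R) : `|Num.max a b - Num.max c d| <= `|a - c| + `|b - d|.
  have := ler_norm (a - c); have := ler_norm (b - d); have := lerNnormlW (lexx `|a - c|);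
  have := lerNnormlW (lexx `|b - d|).
  rewrite ler_norml; case: (leP a b) => ?; case: (leP c d) => ?; move=> ? ? ? ?;
      apply/andP; split; lra.
move=> [m1 [b1 a1]] [m2 [b2 a2]]; split; first exact: measurable_maxr.
split => [x|e e0]; first exact: max01.
have e20 : 0 < e / 2 by rewrite divr_gt0.
have [c1 [[K1 l1] d1 h1]] := a1 _ e20; have [c2 [[K2 l2] d2 h2]] := a2 _ e20.
have mc1 := klipschitz_measurable l1; have mc2 := klipschitz_measurable l2.
exists (fun x => Num.max (c1 x) (c2 x)); split; last 2 first.
- by move=> x; exact: max01.
- apply: (@le_trans _ _ (\int[mu]_x (`|phi x| * `|w1 x - c1 x| + `|phi x| * `|w2 x -
    c2 x|))).
    apply: le_Rintegral => //.
    + by apply: integrable_diff => [||x|x]; [exact: measurable_maxr|exact: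
        measurable_maxr|exact: max01|exact: max01].
    + by apply: integrable_EFinD; exact: integrable_diff.
    + by move=> x _; rewrite -mulrDr ler_wpM2l.
  rewrite RintegralD//; [|exact: integrable_diff..].
  by rewrite [leRHS](splitr e) lerD.
exists (K1 + K2) => x y; rewrite (le_trans (maxB _ _ _ _))// mulrDl.
by rewrite lerD.
Qed.

Lemma lip_approxC w : lip_approx w -> lip_approx (fun x => 1 - w x).
Proof.
have onem01 (a : R) : 0 <= a <= 1 -> 0 <= 1 - a <= 1.
  by move=> /andP[? ?]; apply/andP; lra.
move=> [mw [w01 aw]]; split; first exact: measurable_funB.
split => [x|e /aw[c [[K cK] c01 hc]]]; first exact: onem01.
exists (fun x => 1 - c x); split.
- exists K => x y; rewrite (_ : _ - _ = - (c x - c y)); last by ring.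
  by rewrite normrN; exact: cK.
- by move=> x; exact: onem01.
- rewrite (_ : (fun x => _) = (fun x => `|phi x| * `|w x - c x|))//.
  apply/funext => x; rewrite (_ : 1 - w x - _ = - (w x - c x)); last by ring.
  by rewrite normrN.
Qed.

(* The sets whose indicator is approximable form a sigma-algebra, and ramps show
   that it contains the half-spaces. *)
Lemma lip_approx_indic A : measurable A -> lip_approx (\1_A).
Proof.
move=> mA.
pose S := [set A : set 'rV[R]_n | lip_approx (\1_A)].
have S0 : S set0.
  by rewrite /S/= indic0; apply: (@lip_approx_klipschitz 0) => [x y|x];
    rewrite ?subrr ?normr0 ?mul0r ?lexx ?ler01.
have SC B : S B -> S (~` B).
  move=> /lip_approxC; rewrite /S/=; congr lip_approx; apply/funext => x.
  by rewrite !indicE in_setC; case: (x \in B); rewrite /= ?subrr ?subr0.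
have SU B C : S B -> S C -> S (B `|` C).
  move=> /lip_approx_max h /h; rewrite /S/=; congr lip_approx; apply/funext => x.
  rewrite !indicE in_setU; case: (x \in B); case: (x \in C); rewrite /= ?maxxx//.
    by rewrite max_l.
  by rewrite max_r.
have SsU (F : (set 'rV[R]_n)^nat) : (forall k, S (F k)) -> S (\bigcup_k F k).
  move=> SF; apply: (@lip_approx_cvg (fun k => \1_(\big[setU/set0]_(i < k) F i))).
    by move=> k; rewrite -[lip_approx _]/(S _); apply: big_ind => // i _.
  move=> x; apply: cvg_near_cst; rewrite !indicE.
  have [[k _ Fkx]|nF] := pselect ((\bigcup_k F k) x).
    exists k.+1 => // m /= km; rewrite indicE !mem_set//; first by exists k.
    by rewrite -bigcup_mkord; exists k.
  near=> k; rewrite indicE !memNset// -bigcup_mkord => -[j _ ?].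
  by apply: nF; exists j.
have sS : sigma_algebra setT S.
  by split => // B SB; rewrite setTD; exact: SC.
suff : S A by [].
apply: (smallest_sub sS _ mA) => B; rewrite -bigcup_seq/= => -[i _ [C mC <-]].
rewrite setTI; pose Si := [set C : set R | S ((fun x : 'rV[R]_n => x ord0 i) @^-1` C)].
have sSi : sigma_algebra setT Si.
  split.
  - by rewrite /Si/= preimage_set0.
  - by move=> D; rewrite /Si/= setTD preimage_setC; exact: SC.
  - by move=> F; rewrite /Si/= preimage_bigcup; exact: SsU.
suff : Si C by [].
move: mC; rewrite -[measurable C]/((ocitv (R:=R)).-sigma.-measurable C)
    RGenOInfty.measurableE => mC.
apply: (smallest_sub sSi _ mC) => _ [a ->]; rewrite /Si/= /S/=.
pose w k (x : 'rV[R]_n) : R := Num.min 1 (Num.max 0 (k%:R * (x ord0 i - a))).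
apply: (@lip_approx_cvg w) => [k|x].
  apply: (@lip_approx_klipschitz k%:R) => [x y|x]; last first.
    by rewrite /w le_min ge_min le_max !lexx ler01.
  have xyi : `|(x - y) ord0 i| <= `|x - y| by exact: coord_le_norm.
  rewrite !mxE in xyi; apply: (@le_trans _ _ (k%:R * `|x ord0 i - y ord0 i|)); last first.
    by rewrite ler_wpM2l.
  have -> : k%:R * `|x ord0 i - y ord0 i| =
      `|k%:R * (x ord0 i - a) - k%:R * (y ord0 i - a)|.
    by rewrite -mulrBr normrM ger0_norm//; congr (_ * `|_|); ring.
  rewrite /w; set p := _ * _; set q := k%:R * (y ord0 i - a).
  have := ler_norm (p - q); have := lerNnormlW (lexx `|p - q|).
  rewrite ler_norml; case: (leP 0 p) => ?; case: (leP 0 q) => ?; case: (leP 1 p) =>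
      ?; case: (leP 1 q) => ?;
    case: (leP (1 : R) 0) => ?; move=> ? ?; apply/andP; split; lra.
rewrite indicE; apply: cvg_near_cst.
have [ax|xa] := ltP a (x ord0 i).
  rewrite mem_set; last by rewrite /= in_itv/= ax.
  near=> k; rewrite /w min_l// le_max; apply/orP; right.
  rewrite -ler_pdivrMr ?subr_gt0// div1r.
  by near: k; exact: nbhs_infty_ger.
rewrite memNset; last by rewrite /= in_itv/= andbT; apply/negP; rewrite -leNgt.
near=> k; rewrite /w max_l ?min_r// mulr_ge0_le0// subr_le0//.
Unshelve. all: by end_near. Qed.

(** The exact sign is [2 * \1_A - 1] with [A] the set where [phi >= 0]. Approximating [\1_A] by [c]
    within a quarter of the norm of [phi] costs twice that in [2 * c - 1], so half of the norm
    survives. *)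
Lemma exists_lipschitz_sign : exists sigma : 'rV[R]_n -> R,
  [/\ exists K, klipschitz K sigma, forall x, `|sigma x| <= 1 &
      (\int[mu]_x `|phi x|) / 2 <= \int[mu]_x (phi x * sigma x)].
Proof.
set N := \int[mu]_x `|phi x|.
have mphi : measurable_fun setT phi.
  by apply/measurable_EFinP; exact: measurable_int iphi.
have N0 : 0 <= N by exact: Rintegral_ge0.
have [N00|Nn0] := eqVneq N 0.
  exists (cst 0); split.
  - by exists 0 => x y; rewrite subrr normr0 mul0r.
  - by move=> x; rewrite normr0.
  - rewrite N00 mul0r Rintegral_ge0// => x _; by rewrite mulr0.
have Ngt0 : 0 < N by rewrite lt_neqAle eq_sym Nn0.
pose A := [set x | 0 <= phi x].
have mA : measurable A.
  rewrite (_ : A = setT `&` phi @^-1` `[0, +oo[); first exact: mphi.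
  by rewrite setTI; apply/seteqP; split => x /=; rewrite in_itv/= andbT.
have [m1 [b1 /(_ (N / 4))[|c [[K cK] c01 hc]]]] := lip_approx_indic mA.
  by rewrite divr_gt0.
have mc := klipschitz_measurable cK.
have s1 x : `|2 * c x - 1| <= 1.
  by have /andP[? ?] := c01 x; rewrite ler_norml; apply/andP; lra.
exists (fun x => 2 * c x - 1); split => //.
  exists (2 * K) => x y; rewrite (_ : _ - _ = 2 * (c x - c y)); last by ring.
  by rewrite normrM ger0_norm// -mulrA ler_wpM2l.
have ms : measurable_fun setT (fun x => 2 * c x - 1).
  by apply: measurable_funB => //; exact: measurable_funM.
have i2 := integrable_diff m1 mc b1 c01.
have i3 : mu.-integrable setT (EFin \o (fun x => phi x * (2 * c x - 1))).
  by apply: (@integrable_mulr_bounded _ _ _ _ _ _ 1) => //; apply: aeW => x _.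
suff : N <= \int[mu]_x (phi x * (2 * c x - 1) + 2 * (`|phi x| * `|\1_A x - c x|)).
  rewrite RintegralD//; last exact: integrable_EFinZl.
  by rewrite RintegralZl//; lra.
apply: le_Rintegral => //.
  by apply: integrable_EFinD => //; exact: integrable_EFinZl.
move=> x _; have /andP[? ?] := c01 x.
rewrite indicE; have [Ax|Ax] := pselect (A x).
  by rewrite mem_set//= !ger0_norm ?subr_ge0//; rewrite /A/= in Ax; nra.
rewrite memNset//= sub0r normrN (@ger0_norm _ (c x))//.
have px : phi x < 0 by rewrite ltNge; exact/negP.
by rewrite ltr0_norm//; nra.
Qed.

End lipschitz_density.

(** * Averages along segments *)

Section unit_mean.
Context {R : realType}.
Implicit Types phi Phi : R -> R.

Definition mean01 phi : R := \int[lebesgue_measure]_(r in `[0, 1]) phi r.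

Lemma integrable01 phi : continuous phi ->
  lebesgue_measure.-integrable `[0, 1] (EFin \o phi).
Proof.
move=> cphi; apply: continuous_compact_integrable; first exact: segment_compact.
exact: continuous_subspaceT.
Qed.

Lemma mean01_cst (c : R) : mean01 (cst c) = c.
Proof.
by rewrite /mean01 Rintegral_cst//= lebesgue_measure_itv/= lte01 oppr0 adde0 mulr1.
Qed.

Lemma mean01D phi psi : continuous phi -> continuous psi ->
  mean01 (fun r => phi r + psi r) = mean01 phi + mean01 psi.
Proof. by move=> ? ?; apply: RintegralD => //; exact: integrable01. Qed.

Lemma mean01Z (a : R) phi : continuous phi ->
  mean01 (fun r => a * phi r) = a * mean01 phi.
Proof. by move=> ?; apply: RintegralZl => //; exact: integrable01. Qed.

Lemma mean01_le phi psi : continuous phi -> continuous psi ->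
  (forall r, 0 <= r <= 1 -> phi r <= psi r) -> mean01 phi <= mean01 psi.
Proof.
by move=> ? ? h; apply: le_Rintegral => //; exact: integrable01.
Qed.

Lemma mean01_norm_le phi (C : R) : continuous phi ->
  (forall r, 0 <= r <= 1 -> `|phi r| <= C) -> `|mean01 phi| <= C.
Proof.
move=> cphi phiC; rewrite ler_norml -[- C]mean01_cst -[X in _ && (_ <= X)]mean01_cst.
by apply/andP; split; apply: mean01_le => // [|r /phiC]; try exact: cst_continuous;
  rewrite ler_norml => /andP[].
Qed.

(** The base point [a] is taken to the left of every point in use, so that all means over intervals
    become increments of one and the same primitive. *)
Lemma continuous_primitive phi (a : R) : continuous phi ->
  exists Phi, forall x, a < x -> is_derive x 1 Phi (phi x).
Proof.
move=> cphi; exists (fun x => \int[lebesgue_measure]_(t in `[a, x]) phi t).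
move=> x ax; have [] := @continuous_FTC1 R phi (BLeft a) x (x + 1).
- by rewrite ltrDl.
- apply: continuous_compact_integrable; first exact: segment_compact.
  exact: continuous_subspaceT.
- by rewrite lte_fin.
- exact: cphi.
by move=> dF F'; apply: DeriveDef; [exact: dF|rewrite -derive1E].
Qed.

Section primitive.
Variables (phi Phi : R -> R) (a : R).
Hypothesis cphi : continuous phi.
Hypothesis dPhi : forall x, a < x -> is_derive x 1 Phi (phi x).

Lemma mean01_affine (p b : R) : 0 < b -> a < p ->
  b * mean01 (fun r => phi (p + b * r)) = Phi (p + b) - Phi p.
Proof.
move=> b0 ap.
have ci : continuous (fun r : R => p + b * r).
  move=> x; apply: cvgD; first exact: cvg_cst.
  by apply: cvgM; [exact: cvg_cst|exact: cvg_id].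
have cpsi : continuous (fun r => phi (p + b * r)).
  by move=> x; apply: continuous_comp; [exact: ci|exact: cphi].
rewrite -mean01Z//.
set psi := fun r => _.
have cpsi' : continuous psi.
  by move=> x; apply: cvgM; [exact: cvg_cst|exact: cpsi].
(* The margin [e] keeps [p + b * r] above [a] for [r > - e], hence the primitive differentiable at
   both ends of [[0, 1]], where continuity is required. *)
pose e := (p - a) / b / 2; have e0 : 0 < e by rewrite !divr_gt0// subr_gt0.
have dF r : - e < r -> is_derive r 1 (fun r => Phi (p + b * r)) (psi r).
  move=> er; have apr : a < p + b * r.
    have : b * - e < b * r by rewrite ltr_pM2l.
    rewrite /e !mulrN mulrA mulrCA mulfV ?gt_eqF// mulr1 => h; lra.
  have d1 : is_derive r 1 (fun r : R => p + b * r) b.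
    have := is_deriveD (is_derive_cst p r 1) (is_deriveZ b (is_derive_id r (1 : R))).
    by rewrite add0r scaler1.
  have := @is_derive1_comp R Phi (fun r : R => p + b * r) r _ _ (dPhi apr) d1.
  by rewrite mulrC.
have cF r : - e < r -> {for r, continuous (fun r => Phi (p + b * r))}.
  move=> /dF [dr _]; apply: differentiable_continuous.
  exact/derivable1_diffP.
have := @continuous_FTC2 R psi (fun r => Phi (p + b * r)) 0 1 ltr01.
rewrite mulr0 addr0 mulr1 /mean01 /Rintegral => ->//.
- exact: continuous_subspaceT.
- split.
  + by move=> r; rewrite in_itv/= => /andP[r0 _]; apply: ex_derive; apply: dF; lra.
  + by apply: cvg_at_right_filter; apply: cF; lra.
  + by apply: cvg_at_left_filter; apply: cF; lra.
- move=> r; rewrite in_itv/= => /andP[r0 _]; rewrite derive1E.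
  by apply: derive_val; apply: dF; lra.
Qed.

Lemma mean01_affine_unit (p : R) : a < p ->
  mean01 (fun r => phi (p + r)) = Phi (p + 1) - Phi p.
Proof.
move=> ap; rewrite -(mean01_affine ltr01 ap) mul1r.
by congr mean01; apply/funext => r; rewrite mul1r.
Qed.

Lemma primitive_MVT (p q : R) : a < p -> a < q ->
  exists2 c, `|c - p| <= `|q - p| & Phi q - Phi p = phi c * (q - p).
Proof.
wlog pq : p q / p <= q => [hw|] ap aq.
  have [pq|/ltW qp] := leP p q; first exact: hw.
  have [c cq E] := hw q p qp aq ap.
  have [d dd Ed] : exists2 d, d \in `[q, p] & Phi p - Phi q = phi d * (p - q).
    apply: (MVT_segment qp) => [x|].
      by rewrite in_itv/= => /andP[qx _]; apply: dPhi; lra.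
    apply: derivable_within_continuous => x; rewrite in_itv/= => /andP[qx _].
    by apply: ex_derive; apply: dPhi; lra.
  move: dd; rewrite in_itv/= => /andP[? ?]; exists d; last by lra.
  by rewrite !ler0_norm; lra.
have [d dd Ed] : exists2 d, d \in `[p, q] & Phi q - Phi p = phi d * (q - p).
  apply: (MVT_segment pq) => [x|].
    by rewrite in_itv/= => /andP[qx _]; apply: dPhi; lra.
  apply: derivable_within_continuous => x; rewrite in_itv/= => /andP[qx _].
  by apply: ex_derive; apply: dPhi; lra.
move: dd; rewrite in_itv/= => /andP[? ?]; exists d; last by lra.
by rewrite !ger0_norm; lra.
Qed.

End primitive.

Lemma mean01_double phi : continuous phi ->
  mean01 (fun r => phi (2 * r)) =
  (mean01 phi + mean01 (fun r => phi (1 + r))) / 2.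
Proof.
move=> cphi; have [Phi dPhi] := continuous_primitive (-1) cphi.
have h0 := @mean01_affine phi Phi (-1) cphi dPhi.
have := h0 0 2; have := h0 0 1; have := h0 1 1.
under eq_fun do rewrite mul1r.
under [in X in _ -> X -> _]eq_fun do rewrite mul1r add0r.
under [in X in _ -> _ -> X -> _]eq_fun do rewrite add0r.
rewrite !mul1r !add0r -[1 + 1]/2; lra.
Qed.

(** The difference of the two means regroups as the increment of the primitive from [1] to [t + 1]
    minus that from [0] to [t]. Each covers a length [|t|], so a bound on [phi] suffices, with no
    use of its regularity. *)
Lemma mean01_shift_lip phi (B t : R) : continuous phi -> (forall r, `|phi r| <= B) ->
  `|mean01 (fun r => phi (t + r)) - mean01 phi| <= 2 * B * `|t|.
Proof.
move=> cphi phiB; pose a := - (`|t| + 2).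
have [Phi dPhi] := continuous_primitive a cphi.
have ht : - `|t| <= t by rewrite lerNl -normrN ler_norm.
have t0 : 0 <= `|t| by [].
have [at_ a0 a1 at1] : [/\ a < t, a < 0, a < 1 & a < t + 1].
  by rewrite /a; split; lra.
have E3 := mean01_affine_unit cphi dPhi at_.
have E4 : mean01 phi = Phi 1 - Phi 0.
  rewrite -[in Phi 1](add0r 1) -(mean01_affine_unit cphi dPhi a0).
  by congr mean01; apply/funext => r; rewrite add0r.
rewrite E3 E4.
have [c _ E1] := @primitive_MVT phi Phi a dPhi 0 t a0 at_.
have [d _ E2] := @primitive_MVT phi Phi a dPhi 1 (t + 1) a1 at1.
rewrite (_ : _ - _ = phi d * t - phi c * t); last first.
  by move: E1 E2; rewrite subr0 addrK; lra.
rewrite -mulrBl normrM ler_wpM2r// (le_trans (ler_normB _ _))// mulrDl mul1r.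
by rewrite lerD.
Qed.

(** After the same regrouping, the mean value points lie within [|t|] of [1] and of [0]; replacing
    [phi] there by [phi 1] and [phi 0] costs [K * |t|] each, multiplied by the length [|t|]. *)
Lemma mean01_shift_derive phi (K t : R) : (forall r q, `|phi r - phi q| <= K * `|r -
    q|) ->
  continuous phi ->
  `|mean01 (fun r => phi (t + r)) - mean01 phi - t * (phi 1 - phi 0)| <= 2 * K * t ^+ 2.
Proof.
move=> phiK cphi; pose a := - (`|t| + 2).
have [Phi dPhi] := continuous_primitive a cphi.
have ht : - `|t| <= t by rewrite lerNl -normrN ler_norm.
have t0 : 0 <= `|t| by [].
have K0 : 0 <= K by have := phiK 1 0; rewrite subr0 normr1 mulr1; apply: le_trans.
have [at_ a0 a1 at1] : [/\ a < t, a < 0, a < 1 & a < t + 1].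
  by rewrite /a; split; lra.
have E3 := mean01_affine_unit cphi dPhi at_.
have E4 : mean01 phi = Phi 1 - Phi 0.
  rewrite -[in Phi 1](add0r 1) -(mean01_affine_unit cphi dPhi a0).
  by congr mean01; apply/funext => r; rewrite add0r.
rewrite E3 E4.
have [c hc E1] := @primitive_MVT phi Phi a dPhi 0 t a0 at_.
have [d hd E2] := @primitive_MVT phi Phi a dPhi 1 (t + 1) a1 at1.
rewrite (_ : _ - _ - _ = (phi d - phi 1) * t - (phi c - phi 0) * t); last first.
  by move: E1 E2; rewrite subr0 addrK; lra.
rewrite -mulrBl normrM.
have h1 : `|phi d - phi 1| <= K * `|t|.
  by apply: (le_trans (phiK _ _)); rewrite ler_wpM2l//; move: hd; rewrite addrK.
have h2 : `|phi c - phi 0| <= K * `|t|.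
  by apply: (le_trans (phiK _ _)); rewrite ler_wpM2l//; move: hc; rewrite !subr0.
rewrite -real_normK ?num_real// (_ : 2 * K * `|t| ^+ 2 = (K * `|t| + K * `|t|) *
    `|t|); last by ring.
by rewrite ler_wpM2r// (le_trans (ler_normB _ _))// lerD.
Qed.

End unit_mean.

Section avg.
Context {R : realType} {n : nat}.
Implicit Types (h x y z : 'rV[R]_n) (u w : 'rV[R]_n -> R).

Definition lipschitzf u := exists K, klipschitz K u.

Lemma klipschitz_ge0 (K : R) u : klipschitz K u -> klipschitz `|K| u.
Proof. by move=> uK x y; rewrite (le_trans (uK x y))// ler_wpM2r// ler_norm. Qed.

Lemma klipschitz_line (K : R) u x h : klipschitz K u ->
  klipschitz (K * `|h|) (fun r : R^o => u (x + r *: h)).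
Proof.
move=> uK r q; rewrite (le_trans (uK _ _))//.
rewrite (_ : _ - _ = (r - q) *: h); last first.
  by rewrite opprD addrACA subrr add0r scalerBl.
by rewrite normrZ -mulrA (mulrC `|h|).
Qed.

Lemma lipschitzf_line_continuous u x h : lipschitzf u -> continuous (fun r : R => u
    (x + r *: h)).
Proof. by move=> [K uK]; exact: klipschitz_continuous (klipschitz_line x h uK). Qed.

Arguments lipschitzf_line_continuous {u} x h _.

Definition avg h u x : R := mean01 (fun r => u (x + r *: h)).

(** A bound on a combination of translates that is uniform in the translation passes to averages.
    Suitable coefficients give preservation of bounds, of Lipschitz constants, of directional
    Lipschitz constants and of the remainder in [pderiv]. *)
Lemma avg_lincomb h u1 u2 u3 (a1 a2 a3 C : R) x1 x2 x3 :
  lipschitzf u1 -> lipschitzf u2 -> lipschitzf u3 ->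
  (forall z, `|a1 * u1 (x1 + z) + a2 * u2 (x2 + z) + a3 * u3 (x3 + z)| <= C) ->
  `|a1 * avg h u1 x1 + a2 * avg h u2 x2 + a3 * avg h u3 x3| <= C.
Proof.
move=> l1 l2 l3 hC; rewrite /avg.
have c1 := lipschitzf_line_continuous x1 h l1.
have c2 := lipschitzf_line_continuous x2 h l2.
have c3 := lipschitzf_line_continuous x3 h l3.
have cM (a : R) (f : R -> R) : continuous f -> continuous (fun r => a * f r).
  by move=> cf r; apply: cvgM; [exact: cvg_cst|exact: cf].
have c12 : continuous (fun r : R => a1 * u1 (x1 + r *: h) + a2 * u2 (x2 + r *: h)).
  by move=> r; apply: cvgD; exact: cM.
rewrite -!mean01Z// -!mean01D//; [|exact: cM..].
apply: mean01_norm_le => // r; apply: cvgD; [exact: c12|exact: cM].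
Qed.

Lemma lipschitzf0 : lipschitzf (cst 0).
Proof. by exists 0 => x y; rewrite subrr normr0 mul0r. Qed.

Lemma lipschitzfD u w : lipschitzf u -> lipschitzf w -> lipschitzf (fun x => u x + w x).
Proof.
move=> [K uK] [L wL]; exists (K + L) => x y.
rewrite opprD addrACA (le_trans (ler_normD _ _))// mulrDl.
by apply: lerD; [exact: uK|exact: wL].
Qed.

Lemma lipschitzfZ (a : R) u : lipschitzf u -> lipschitzf (fun x => a * u x).
Proof.
move=> [K uK]; exists (`|a| * K) => x y.
by rewrite -mulrBr normrM -mulrA ler_wpM2l.
Qed.

Lemma lipschitzf_shift z u : lipschitzf u -> lipschitzf (fun x => u (x + z)).
Proof.
move=> [K uK]; exists K => x y; rewrite (le_trans (uK _ _))//.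
by rewrite opprD addrACA subrr addr0.
Qed.

Lemma lipschitzfB u w : lipschitzf u -> lipschitzf w -> lipschitzf (fun x => u x - w x).
Proof.
move=> lu lw; have := lipschitzfD lu (lipschitzfZ (-1) lw).
by congr lipschitzf; apply/funext => x; rewrite mulN1r.
Qed.

Lemma avg_klipschitz h (K : R) u : klipschitz K u -> klipschitz K (avg h u).
Proof.
move=> uK x y; have lu : lipschitzf u by exists K.
have := @avg_lincomb h u u u 1 (-1) 0 (K * `|x - y|) x y x lu lu lu.
rewrite mul0r addr0 mul1r mulN1r; apply => z.
rewrite mul0r addr0 mul1r mulN1r (le_trans (uK _ _))//.
by rewrite opprD addrACA subrr addr0.
Qed.

Lemma avg_lipschitzf h u : lipschitzf u -> lipschitzf (avg h u).
Proof. by move=> [K uK]; exists K; exact: avg_klipschitz. Qed.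

Lemma avg_bound h (B : R) u : lipschitzf u -> (forall x, `|u x| <= B) ->
  forall x, `|avg h u x| <= B.
Proof.
move=> lu uB x; have := @avg_lincomb h u u u 1 0 0 B x x x lu lu lu.
by rewrite !mul0r !addr0 mul1r; apply => z; rewrite !mul0r !addr0 mul1r.
Qed.

Lemma avgB h u w : lipschitzf u -> lipschitzf w ->
  avg h (fun x => u x - w x) = (fun x => avg h u x - avg h w x).
Proof.
move=> lu lw; apply/funext => x.
have cu := lipschitzf_line_continuous x h lu; have cw := lipschitzf_line_continuous x
    h lw.
rewrite /avg -mulN1r -mean01Z// -mean01D//.
  by congr mean01; apply/funext => r; rewrite mulN1r.
by move=> r; apply: cvgM; [exact: cvg_cst|exact: cw].
Qed.

Lemma avgD h u w : lipschitzf u -> lipschitzf w ->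
  avg h (fun x => u x + w x) = (fun x => avg h u x + avg h w x).
Proof.
by move=> lu lw; apply/funext => x; apply: mean01D; exact: lipschitzf_line_continuous.
Qed.

Lemma avg_sum h (I : finType) (F : I -> 'rV[R]_n -> R) : (forall i, lipschitzf (F i)) ->
  avg h (fun x => \sum_i F i x) = (fun x => \sum_i avg h (F i) x).
Proof.
move=> lF; rewrite (_ : (fun x => \sum_i F i x) = \sum_i F i); last first.
  by apply/funext => x; rewrite fct_sumE.
rewrite (_ : (fun x => \sum_i avg h (F i) x) = \sum_i avg h (F i)); last first.
  by apply/funext => x; rewrite fct_sumE.
suff [] : lipschitzf (\sum_i F i) /\ avg h (\sum_i F i) = \sum_i avg h (F i) by [].
elim/big_ind2 : _ => //.
- by split; [exact: lipschitzf0|apply/funext => x; rewrite /avg mean01_cst].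
- move=> u1 v1 u2 v2 [l1 e1] [l2 e2]; split; first exact: lipschitzfD.
  by rewrite [LHS]avgD// e1 e2.
Qed.

Lemma avg_near h (K : R) u x : klipschitz K u -> `|avg h u x - u x| <= `|K| * `|h|.
Proof.
move=> uK; have lu : lipschitzf u by exists K.
have cu := lipschitzf_line_continuous x h lu.
rewrite /avg -[X in _ - X]mean01_cst -mulN1r -mean01Z; last by move=> r; exact: cvg_cst.
rewrite -mean01D//; last by move=> r; apply: cvgM; exact: cvg_cst.
apply: mean01_norm_le => [r|r /andP[r0 r1]].
  by apply: cvgD; [exact: cu|apply: cvgM; exact: cvg_cst].
rewrite mulN1r (le_trans (klipschitz_ge0 uK _ _))// ler_wpM2l//.
by rewrite addrAC subrr add0r normrZ ger0_norm// ler_piMl.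
Qed.

Lemma avg_double h u x : lipschitzf u ->
  avg (2 *: h) u x = (avg h u x + avg h u (x + h)) / 2.
Proof.
move=> lu; have := mean01_double (lipschitzf_line_continuous x h lu).
rewrite /avg => E; transitivity (mean01 (fun r => u (x + (2 * r) *: h))).
  by congr mean01; apply/funext => r; rewrite scalerA mulrC.
rewrite E; congr ((_ + _) / 2); congr mean01; apply/funext => r.
by rewrite scalerDl scale1r addrA.
Qed.

Lemma avg_shiftE h u x (t : R) :
  avg h u (x + t *: h) = mean01 (fun r => u (x + (t + r) *: h)).
Proof. by congr mean01; apply/funext => r; rewrite scalerDl addrA. Qed.

Lemma avg_shift_lip h (B : R) u x (t : R) : lipschitzf u -> (forall x, `|u x| <= B) ->
  `|avg h u (x + t *: h) - avg h u x| <= 2 * B * `|t|.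
Proof.
move=> lu uB; rewrite avg_shiftE.
exact: (mean01_shift_lip t (lipschitzf_line_continuous x h lu)).
Qed.

(* The remainder is uniform in [x], so that averages of [w] are differentiable
   with no interchange of limits. *)
Definition pderiv h w w' :=
  exists K : R, forall x (t : R), `|w (x + t *: h) - w x - t * w' x| <= K * t ^+ 2.

Lemma avg_shift_derive h u : lipschitzf u -> pderiv h (avg h u) (fun x => u (x + h) -
    u x).
Proof.
move=> lu; have [K uK] := lu; exists (2 * (K * `|h|)) => x t; rewrite avg_shiftE.
have := @mean01_shift_derive _ (fun r => u (x + r *: h)) (K * `|h|) t _
  (lipschitzf_line_continuous x h lu).
by rewrite scale1r scale0r addr0; apply => r q; exact: klipschitz_line.
Qed.

Lemma avg_pderiv h k w w' : lipschitzf w -> lipschitzf w' -> pderiv k w w' ->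
  pderiv k (avg h w) (avg h w').
Proof.
move=> lw lw' [K hK]; exists K => x t.
have := @avg_lincomb h w w w' 1 (-1) (- t) (K * t ^+ 2) (x + t *: k) x x lw lw lw'.
rewrite mul1r mulN1r mulNr; apply => z; rewrite mul1r mulN1r mulNr.
by rewrite (addrAC x).
Qed.

Lemma pderivD h w1 w2 w1' w2' : pderiv h w1 w1' -> pderiv h w2 w2' ->
  pderiv h (fun x => w1 x + w2 x) (fun x => w1' x + w2' x).
Proof.
move=> [K hK] [L hL]; exists (K + L) => x t.
rewrite (_ : _ - _ - _ = (w1 (x + t *: h) - w1 x - t * w1' x) +
  (w2 (x + t *: h) - w2 x - t * w2' x)); last by ring.
by rewrite (le_trans (ler_normD _ _))// mulrDl lerD.
Qed.

Lemma pderivZ h (a : R) w w' : pderiv h w w' ->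
  pderiv h (fun x => a * w x) (fun x => a * w' x).
Proof.
move=> [K hK]; exists (`|a| * K) => x t.
rewrite (_ : _ - _ - _ = a * (w (x + t *: h) - w x - t * w' x)); last by ring.
by rewrite normrM -mulrA ler_wpM2l.
Qed.

Lemma pderiv_dirZ h (c : R) w w' : c != 0 -> pderiv (c *: h) w w' ->
  pderiv h w (fun x => c^-1 * w' x).
Proof.
move=> c0 [K hK]; exists (K * c ^- 2) => x t.
have -> : t * (c^-1 * w' x) = t / c * w' x by rewrite mulrA.
have -> : K * c ^- 2 * t ^+ 2 = K * (t / c) ^+ 2 by field.
by have := hK x (t / c); rewrite scalerA divfK.
Qed.

Lemma pderiv0 h : pderiv h (cst 0) (cst 0).
Proof. by exists 0 => x t; rewrite mulr0 !subr0 normr0 mul0r. Qed.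

End avg.

(** * Divergences of smooth fields *)

Section fields.
Context {R : realType} {d : nat}.
Implicit Types (h x y z : 'rV[R]_d) (u w g : 'rV[R]_d -> R) (i j : 'I_d).

Definition unit_rV j : 'rV[R]_d := delta_mx ord0 j.

Lemma norm_unit_rV j : `|unit_rV j| = 1.
Proof.
apply/eqP; rewrite eq_le; apply/andP; split.
  rewrite rV_norm_le//; apply/forallP => i; rewrite mxE eqxx/=.
  by case: eqP; rewrite ?normr1 ?normr0.
by have := coord_le_norm (unit_rV j) j; rewrite mxE !eqxx normr1.
Qed.

Definition dirlipschitz j (L : R) w := forall x (t : R),
  `|w (x + t *: unit_rV j) - w x| <= L * `|t|.

(** Requiring a Lipschitz derivative is what later yields a total derivative, with quadratic
    remainder, and its continuity. *)
Definition smooth_dir j w := exists2 w', lipschitzf w' & pderiv (unit_rV j) w w'.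

Lemma avg_dirlipschitz h j (L : R) w : lipschitzf w -> dirlipschitz j L w ->
    dirlipschitz j L (avg h w).
Proof.
move=> lw wL x t.
have := @avg_lincomb _ _ h w w w 1 (-1) 0 (L * `|t|) (x + t *: unit_rV j) x x lw lw lw.
rewrite mul0r addr0 mul1r mulN1r; apply => z; rewrite mul0r addr0 mul1r mulN1r.
by rewrite (addrAC x).
Qed.

Lemma avg_smooth_dir h j w : lipschitzf w -> smooth_dir j w -> smooth_dir j (avg h w).
Proof.
move=> lw [w' lw' ww']; exists (avg h w'); first exact: avg_lipschitzf.
exact: avg_pderiv.
Qed.

Lemma avg_unit_rV_dirlipschitz j (c B : R) u : 0 < c -> lipschitzf u -> (forall x,
    `|u x| <= B) ->
  dirlipschitz j (2 * B / c) (avg (c *: unit_rV j) u).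
Proof.
move=> c0 lu uB x t; have := avg_shift_lip (c *: unit_rV j) x (t / c) lu uB.
rewrite scalerA divfK ?gt_eqF// normrM normfV (gtr0_norm c0) => /le_trans; apply.
by rewrite mulrA mulrAC.
Qed.

Lemma avg_unit_rV_smooth_dir j (c : R) u : 0 < c -> lipschitzf u ->
  smooth_dir j (avg (c *: unit_rV j) u).
Proof.
move=> c0 lu; have := pderiv_dirZ (lt0r_neq0 c0) (avg_shift_derive (c *: unit_rV j) lu).
apply: ex_intro2; apply: lipschitzfZ; apply: lipschitzfB => //; exact: lipschitzf_shift.
Qed.

Lemma dirlipschitzW j (L L' : R) w : L <= L' -> dirlipschitz j L w -> dirlipschitz j L' w.
Proof. by move=> LL' wL x t; rewrite (le_trans (wL x t))// ler_wpM2r. Qed.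

Lemma dirlipschitzZ j (a L : R) w : dirlipschitz j L w -> dirlipschitz j (`|a| * L)
    (fun x => a * w x).
Proof. by move=> wL x t; rewrite -mulrBr normrM -mulrA ler_wpM2l. Qed.

Lemma dirlipschitzD j (L1 L2 : R) w1 w2 : dirlipschitz j L1 w1 -> dirlipschitz j L2 w2 ->
  dirlipschitz j (L1 + L2) (fun x => w1 x + w2 x).
Proof.
move=> h1 h2 x t; rewrite opprD addrACA (le_trans (ler_normD _ _))// mulrDl.
exact: lerD.
Qed.

Lemma smooth_dirZ j (a : R) w : smooth_dir j w -> smooth_dir j (fun x => a * w x).
Proof.
move=> [w' lw' ww']; exists (fun x => a * w' x); first exact: lipschitzfZ.
exact: pderivZ.
Qed.

Lemma smooth_dirD j w1 w2 : smooth_dir j w1 -> smooth_dir j w2 ->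
  smooth_dir j (fun x => w1 x + w2 x).
Proof.
move=> [v1 l1 h1] [v2 l2 h2]; exists (fun x => v1 x + v2 x); first exact: lipschitzfD.
exact: pderivD.
Qed.

Lemma smooth_dir0 j : smooth_dir j (cst 0).
Proof. exists (cst 0); [exact: lipschitzf0|exact: pderiv0]. Qed.

(* [g] is the divergence [\sum_i G i] of the field [F]; the bounds [L] and the
   smoothness of [F] are only recorded along the axes listed in [s], the ones
   along which an average has already been taken. *)
Definition bounded_field (s : seq 'I_d) (B L : R) g :=
  exists F G : 'I_d -> 'rV[R]_d -> R,
  [/\ forall i, lipschitzf (F i), forall i x, `|F i x| <= B,
      forall i j, j \in s -> dirlipschitz j L (F i) /\ smooth_dir j (F i),
      forall i, lipschitzf (G i) /\ pderiv (unit_rV i) (F i) (G i) &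
      g = (fun x => \sum_i G i x)].

(** Averaging commutes with [pderiv], so the averaged field has the averaged divergence and keeps
    its bounds. Along the new axis the field becomes Lipschitz with constant [2 * B / c], whence the
    condition on [L]. *)
Lemma bounded_field_avg_cons j s (c B L : R) g : 0 < c -> 2 * B / c <= L ->
  bounded_field s B L g -> bounded_field (j :: s) B L (avg (c *: unit_rV j) g).
Proof.
move=> c0 BL [F [G [lF FB FL FG ->]]].
exists (fun i => avg (c *: unit_rV j) (F i)), (fun i => avg (c *: unit_rV j) (G i));
    split.
- by move=> i; exact: avg_lipschitzf.
- by move=> i; exact: avg_bound.
- move=> i k; rewrite inE => /predU1P[->|ks].
    split; last exact: avg_unit_rV_smooth_dir.
    exact: dirlipschitzW BL (avg_unit_rV_dirlipschitz _ c0 (lF i) (FB i)).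
  have [? ?] := FL i k ks.
  by split; [exact: avg_dirlipschitz|exact: avg_smooth_dir].
- by move=> i; have [? ?] := FG i; split; [exact: avg_lipschitzf|exact: avg_pderiv].
- by rewrite avg_sum// => i; case: (FG i).
Qed.

Lemma bounded_fieldD s (B1 B2 L1 L2 : R) g1 g2 : bounded_field s B1 L1 g1 ->
  bounded_field s B2 L2 g2 -> bounded_field s (B1 + B2) (L1 + L2) (fun x => g1 x + g2 x).
Proof.
move=> [F1 [G1 [lF1 FB1 FL1 FG1 ->]]] [F2 [G2 [lF2 FB2 FL2 FG2 ->]]].
exists (fun i x => F1 i x + F2 i x), (fun i x => G1 i x + G2 i x); split.
- by move=> i; exact: lipschitzfD.
- by move=> i x; rewrite (le_trans (ler_normD _ _))// lerD.
- move=> i j js; have [? ?] := FL1 i j js; have [? ?] := FL2 i j js.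
  by split; [exact: dirlipschitzD|exact: smooth_dirD].
- move=> i; have [? ?] := FG1 i; have [? ?] := FG2 i.
  by split; [exact: lipschitzfD|exact: pderivD].
- by apply/funext => x; rewrite big_split.
Qed.

Lemma bounded_fieldZ s (a B L : R) g : bounded_field s B L g ->
  bounded_field s (`|a| * B) (`|a| * L) (fun x => a * g x).
Proof.
move=> [F [G [lF FB FL FG ->]]].
exists (fun i x => a * F i x), (fun i x => a * G i x); split.
- by move=> i; exact: lipschitzfZ.
- by move=> i x; rewrite normrM ler_wpM2l.
- move=> i j js; have [? ?] := FL i j js.
  by split; [exact: dirlipschitzZ|exact: smooth_dirZ].
- by move=> i; have [? ?] := FG i; split; [exact: lipschitzfZ|exact: pderivZ].
- by apply/funext => x; rewrite mulr_sumr.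
Qed.

Lemma bounded_field0 (B L : R) : 0 <= B -> bounded_field [::] B L (cst 0).
Proof.
move=> B0; exists (fun=> cst 0), (fun=> cst 0); split => //.
- by move=> i; exact: lipschitzf0.
- by move=> i x; rewrite normr0.
- by move=> i; split; [exact: lipschitzf0|exact: pderiv0].
- by apply/funext => x; rewrite big1.
Qed.

(** The field has a single component, the [i]-th, equal to [t] times the average of [u] over the
    segment from [x] to [x + t e_i]: its derivative along [e_i] telescopes to the difference. The
    step [t] may be negative. *)
Lemma bounded_field_diff s i (t B L : R) u : lipschitzf u -> (forall x, `|u x| <= B) ->
  (forall j, j \in s -> dirlipschitz j L u /\ smooth_dir j u) -> 0 <= B -> 0 <= L ->
  bounded_field s (`|t| * B) (`|t| * L) (fun x => u (x + t *: unit_rV i) - u x).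
Proof.
move=> lu uB us B0 L0.
exists (fun k => if k == i then (fun x => t * avg (t *: unit_rV i) u x) else cst 0).
exists (fun k => if k == i then (fun x => u (x + t *: unit_rV i) - u x) else cst 0).
split.
- by move=> k; case: ifP => _; [apply: lipschitzfZ; exact: avg_lipschitzf|exact:
    lipschitzf0].
- move=> k x; case: ifP => _; last by rewrite normr0 mulr_ge0.
  by rewrite normrM ler_wpM2l// avg_bound.
- move=> k j js; have [jL js'] := us _ js; case: ifP => _.
    split; first by apply/dirlipschitzZ/avg_dirlipschitz.
    exact/smooth_dirZ/avg_smooth_dir.
  split; last exact: smooth_dir0.
  by move=> x r; rewrite subrr normr0 !mulr_ge0.
- move=> k; case: ifP => [/eqP ->|_]; last by split; [exact: lipschitzf0|exact: pderiv0].
  split; first by apply: lipschitzfB => //; exact: lipschitzf_shift.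
  (* [pderiv_dirZ] divides by [t]; for [t = 0] both the component and the difference vanish. *)
  have [->|t0] := eqVneq t 0.
    rewrite (_ : (fun x => _ - _) = cst 0); last first.
      by apply/funext => x; rewrite scale0r addr0 subrr.
    rewrite (_ : (fun x => _ * _) = cst 0); first exact: pderiv0.
    by apply/funext => x; rewrite mul0r.
  have := pderivZ t (pderiv_dirZ t0 (avg_shift_derive (t *: unit_rV i) lu)).
  by congr pderiv; apply/funext => x; rewrite mulrA mulfV// mul1r.
- apply/funext => x; rewrite (bigD1 i)//= eqxx big1 ?addr0// => k /negbTE ->.
  by [].
Qed.

(** With all axes listed once, this is the mean of [u] over the cube of side [c] having [x] as its
    lowest corner, for [c > 0]. *)
Definition avgs (c : R) (s : seq 'I_d) u := foldr (fun j => avg (c *: unit_rV j)) u s.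

Lemma avgs_lipschitzf c s u : lipschitzf u -> lipschitzf (avgs c s u).
Proof. by move=> lu; elim: s => //= j s IH; exact: avg_lipschitzf. Qed.

Lemma avgs_bound c s (B : R) u : lipschitzf u -> (forall x, `|u x| <= B) ->
  forall x, `|avgs c s u x| <= B.
Proof.
by move=> lu uB; elim: s => //= j s IH; apply: avg_bound => //; exact: avgs_lipschitzf.
Qed.

Lemma avgsB c s u w : lipschitzf u -> lipschitzf w ->
  avgs c s (fun x => u x - w x) = (fun x => avgs c s u x - avgs c s w x).
Proof.
by move=> lu lw; elim: s => //= j s ->; rewrite avgB//; exact: avgs_lipschitzf.
Qed.

Lemma avgs_shift c s u z : avgs c s (fun x => u (x + z)) = (fun x => avgs c s u (x + z)).
Proof.
elim: s => //= j s ->; apply/funext => x; congr mean01; apply/funext => r.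
by rewrite addrAC.
Qed.

Lemma avgs_near c s (K : R) u : klipschitz K u ->
  forall x, `|avgs c s u x - u x| <= (size s)%:R * (`|K| * `|c|).
Proof.
move=> uK; have lu : lipschitzf u by exists K.
suff [] : klipschitz K (avgs c s u) /\
  forall x, `|avgs c s u x - u x| <= (size s)%:R * (`|K| * `|c|) by [].
elim: s => [|j s [IK IH]] /=; first by split => // x; rewrite subrr normr0 mul0r.
split; first exact: avg_klipschitz.
move=> x; have := avg_near (c *: unit_rV j) x IK; rewrite normrZ norm_unit_rV mulr1.
move=> h1; have h2 := IH x.
rewrite -natr1 mulrDl mul1r (le_trans (ler_distD (avgs c s u x) _ _))// addrC.
exact: lerD.
Qed.

Lemma avgs_smooth (c B : R) s u : 0 < c -> lipschitzf u -> (forall x, `|u x| <= B) ->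
  forall j, j \in s -> dirlipschitz j (2 * B / c) (avgs c s u) /\ smooth_dir j (avgs
      c s u).
Proof.
move=> c0 lu uB; elim: s => //= i s IH j.
rewrite inE => /predU1P[->|/IH[h1 h2]].
  split; last by apply: avg_unit_rV_smooth_dir => //; exact: avgs_lipschitzf.
  by apply: avg_unit_rV_dirlipschitz => //; [exact: avgs_lipschitzf|exact: avgs_bound].
by split; [apply: avg_dirlipschitz|apply: avg_smooth_dir] => //; exact: avgs_lipschitzf.
Qed.

(* From the inside out, each axis contributes
   [A_c - A_(2c) = - 1/2 (A_c (. + c e_j) - A_c)]. *)
Lemma bounded_field_halve (c B : R) s u : 0 < c -> 0 <= B -> lipschitzf u -> (forall
    x, `|u x| <= B) ->
  bounded_field s ((size s)%:R * (c * B / 2)) ((size s)%:R * B)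
    (fun x => avgs c s u x - avgs (2 * c) s u x).
Proof.
move=> c0 B0 lu uB; elim: s => [|j s IH] /=.
  rewrite (_ : (fun x => _) = cst 0); first by apply: bounded_field0; rewrite mul0r.
  by apply/funext => x; rewrite subrr.
pose U' := avgs c s u; pose U := avgs (2 * c) s u; pose W := avg (c *: unit_rV j) U.
have lU : lipschitzf U by exact: avgs_lipschitzf.
have lU' : lipschitzf U' by exact: avgs_lipschitzf.
have UB : forall x, `|U x| <= B by exact: avgs_bound.
rewrite (_ : (fun x => _) = (fun x => avg (c *: unit_rV j) (fun x => U' x - U x) x +
    - 2^-1 * (W (x + c *: unit_rV j) - W x))); last first.
  apply/funext => x; rewrite avgB//.
  transitivity (avg (c *: unit_rV j) U' x - avg ((2 * c) *: unit_rV j) U x) => //.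
  rewrite -scalerA avg_double// -/W; move: (W x) (W _) (avg _ U' x) => a b e.
  lra.
rewrite -natr1 !mulrDl !mul1r; apply: bounded_fieldD.
  (* The two constants of the statement are tuned to this call: with [n] axes done,
     [2 * (n * (c * B / 2)) / c] is exactly [n * B]. *)
  apply: bounded_field_avg_cons => //.
  by rewrite (_ : 2 * _ / c = (size s)%:R * B)//; field; rewrite gt_eqF.
have -> : c * B / 2 = `|- 2^-1| * (`|c| * B).
  by rewrite normrN normfV !ger0_norm// ?ltW// mulrC.
have -> : B = `|- 2^-1| * (`|c| * (2 * B / c)).
  rewrite normrN normfV !ger0_norm// ?ltW//; field; by rewrite gt_eqF.
apply: bounded_fieldZ; rewrite (_ : `|- 2^-1| * (`|c| * (2 * B / c)) = B); last first.
  rewrite normrN normfV !ger0_norm// ?ltW//; field; by rewrite gt_eqF.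
apply: bounded_field_diff => //.
- exact: avg_lipschitzf.
- exact: avg_bound.
- move=> k; rewrite inE => /predU1P[->|ks].
    by split; [exact: avg_unit_rV_dirlipschitz|exact: avg_unit_rV_smooth_dir].
  have c20 : 0 < 2 * c by rewrite mulr_gt0.
  have [h1 h2] := avgs_smooth c20 lu uB ks.
  split; last exact: avg_smooth_dir.
  apply: avg_dirlipschitz => //; apply: dirlipschitzW h1.
  by rewrite ler_wpM2l ?mulr_ge0// lef_pV2 ?posrE//; lra.
- by rewrite divr_ge0 ?mulr_ge0// ltW.
Qed.

End fields.

(** * From directional estimates to C^1 fields *)

Section coordinates.
Context {R : realType} {d : nat}.
Implicit Types (h x y z : 'rV[R]_d) (u w g : 'rV[R]_d -> R) (i j : 'I_d).

(** The corners of a staircase from [0] to [h] with one step per axis, along which directional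
    estimates are added up. *)
Definition trunc_rV k h : 'rV[R]_d := \row_i (if (i < k)%N then h ord0 i else 0).

Lemma trunc_rV0 h : trunc_rV 0 h = 0.
Proof. by apply/rowP => i; rewrite !mxE. Qed.

Lemma trunc_rV_all h : trunc_rV d h = h.
Proof. by apply/rowP => i; rewrite !mxE ltn_ord. Qed.

Lemma trunc_rVS j h : trunc_rV j.+1 h = trunc_rV j h + h ord0 j *: unit_rV j.
Proof.
apply/rowP => i; rewrite !mxE eqxx/= ltnS leq_eqVlt val_eqE.
by have [->|] := eqVneq i j; rewrite ?ltnn/= ?mulr1 ?add0r// mulr0 addr0.
Qed.

Lemma norm_trunc_rV k h : `|trunc_rV k h| <= `|h|.
Proof.
rewrite rV_norm_le//; apply/forallP => i; rewrite !mxE.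
by case: ifP => _; rewrite ?normr0// coord_le_norm.
Qed.

Lemma dirlipschitz_klipschitz (L : R) w : 0 <= L -> (forall j, dirlipschitz j L w) ->
    klipschitz (d%:R * L) w.
Proof.
move=> L0 wL x y.
suff h k z h : (k <= d)%N -> `|w (z + trunc_rV k h) - w z| <= k%:R * L * `|h|.
  by have := h d y (x - y) (leqnn _); rewrite trunc_rV_all (addrC y) subrK.
elim: k => [|k IH] kd; first by rewrite trunc_rV0 addr0 subrr normr0 !mul0r.
rewrite (trunc_rVS (Ordinal kd)) addrA /=; set a := z + _.
rewrite (le_trans (ler_distD (w a) _ _))// -natr1 !mulrDl mul1r [leLHS]addrC.
apply: lerD; first exact: IH (ltnW kd).
by rewrite (le_trans (wL _ _ _))// ler_wpM2l// coord_le_norm.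
Qed.

(** Along the staircase the increment on axis [j] involves [w' j] at the corner [a] instead of at
    [x]. Since [w' j] is Lipschitz and [a - x] is a truncation of [h], moving it back to [x] costs a
    further multiple of [|h| ^+ 2]. *)
Lemma pderiv_frechet w (w' : 'I_d -> 'rV[R]_d -> R) :
  (forall j, lipschitzf (w' j)) -> (forall j, pderiv (unit_rV j) w (w' j)) ->
  exists2 C, 0 <= C & forall x h,
    `|w (x + h) - w x - \sum_j h ord0 j * w' j x| <= C * `|h| ^+ 2.
Proof.
move=> lw' ww'.
suff H k : (k <= d)%N -> exists2 C, 0 <= C & forall x h,
    `|w (x + trunc_rV k h) - w x - \sum_(j < d | (j < k)%N) h ord0 j * w' j x| <= C *
        `|h| ^+ 2.
  have [C C0 HC] := H d (leqnn _); exists C => // x h.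
  have := HC x h; rewrite trunc_rV_all; congr (`|_ - _| <= _).
  by apply: eq_bigl => j; rewrite ltn_ord.
elim: k => [|k IH] kd.
  exists 0 => // x h; rewrite big_pred0// trunc_rV0 addr0 !subrr normr0.
  by rewrite mul0r.
have [C C0 HC] := IH (ltnW kd); pose j := Ordinal kd.
have [K HK] := ww' j; have [L /klipschitz_ge0 HL] := lw' j.
exists (C + (`|K| + `|L|)); first by rewrite !addr_ge0.
move=> x h; rewrite (trunc_rVS j) (bigD1 j)//= addrA.
set a := x + _; have -> : \sum_(i < d | (i < k.+1)%N && (i != j)) h ord0 i * w' i x =
    \sum_(i < d | (i < k)%N) h ord0 i * w' i x.
  by apply: eq_bigl => i; rewrite ltnS (leq_eqVlt i) -val_eqE/=; case: ltngtP.
set S := \sum_(_ < d | _) _; set t := h ord0 j.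
rewrite (_ : _ - _ - _ = (w a - w x - S) + ((w (a + t *: unit_rV j) - w a - t * w' j a) +
  t * (w' j a - w' j x))); last by ring.
have th : `|t| <= `|h| by exact: coord_le_norm.
rewrite (le_trans (ler_normD _ _))// mulrDl lerD//; first exact: HC.
rewrite (le_trans (ler_normD _ _))// mulrDl lerD//.
  rewrite (le_trans (HK _ _))// -(real_normK (num_real t)).
  apply: (@le_trans _ _ (`|K| * `|t| ^+ 2)).
    by rewrite ler_wpM2r ?exprn_ge0// ler_norm.
  by rewrite ler_wpM2l// lerXn2r// nnegrE.
rewrite normrM expr2 mulrCA ler_pM// (le_trans (HL _ _))// ler_wpM2l//.
by rewrite addrAC subrr add0r norm_trunc_rV.
Qed.

Lemma pderiv_derive h w w' : pderiv h w w' -> forall x, 'D_h w x = w' x.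
Proof.
move=> [K HK] x; apply/cvg_lim => //; apply/cvgrPdist_lt => e e0.
have K0 : 0 < `|K| + 1 by rewrite ltr_wpDl.
near=> t; have t0 : t != 0 by near: t; exact: nbhs_dnbhs_neq.
rewrite /= distrC.
rewrite (_ : _ - _ = t^-1 * (w (x + t *: h) - w x - t * w' x)); last first.
  by rewrite [t *: h + x]addrC -[_ *: _]/(_ * _); field.
rewrite normrM normfV ltr_pdivrMl ?normr_gt0//.
apply: (le_lt_trans (HK x t)); rewrite -(real_normK (num_real t)).
apply: (@le_lt_trans _ _ ((`|K| + 1) * `|t| * `|t|)).
  by rewrite expr2 mulrA !ler_wpM2r// (le_trans (ler_norm K))// lerDl.
rewrite [ltRHS]mulrC ltr_pM2r ?normr_gt0// -ltr_pdivlMl//.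
by near: t; apply: dnbhs0_lt; rewrite mulr_gt0// invr_gt0.
Unshelve. all: by end_near. Qed.

(** The quadratic remainders of [pderiv_frechet] identify the differential at [x] as right
    multiplication by [J x], and [J] inherits a Lipschitz bound from its entries. *)
Lemma C1_of_smooth (F : 'I_d -> 'rV[R]_d -> R) :
  (forall i, lipschitzf (F i)) -> (forall i j, smooth_dir j (F i)) ->
  C1 (fun x => \row_i F i x).
Proof.
move=> lF sF; pose v x := \row_i F i x.
have /choice[w' w'P] : forall ij : 'I_d * 'I_d, exists w', lipschitzf w' /\ pderiv
    (unit_rV ij.2) (F ij.1) w'.
  by move=> [i j]; have [w' ? ?] := sF i j; exists w'.
(* Rows index directions and columns index components, since differentials act on row vectors from
   the right. *)
pose J x := \matrix_(j, i) w' (i, j) x.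
have /choice[C HC] : forall i, exists C, 0 <= C /\ forall x h,
    `|F i (x + h) - F i x - \sum_j h ord0 j * w' (i, j) x| <= C * `|h| ^+ 2.
  move=> i; have [C C0 HC] := @pderiv_frechet (F i) (fun j => w' (i, j))
    (fun j => (w'P (i, j)).1) (fun j => (w'P (i, j)).2).
  by exists C.
pose D := \sum_i C i.
have D0 : 0 <= D by apply: sumr_ge0 => i _; case: (HC i).
have vD x h : `|v (h + x) - v x - h *m J x| <= D * `|h| ^+ 2.
  rewrite rV_norm_le ?mulr_ge0// ?exprn_ge0//; apply/forallP => i; rewrite !mxE.
  have [Ci0 /(_ x h)] := HC i; rewrite (addrC x) => Hi.
  under eq_bigr do rewrite mxE.
  rewrite (le_trans Hi)// ler_wpM2r ?exprn_ge0//.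
  by rewrite /D (bigD1 i)//= lerDl sumr_ge0// => k _; case: (HC k).
have cJ x : continuous (mulmxr (J x) : 'rV[R]_d -> 'rV[R]_d).
  pose N := \sum_i \sum_j `|J x j i|.
  have N0 : 0 <= N by apply: sumr_ge0 => i _; exact: sumr_ge0.
  have NJ h : `|h *m J x| <= N * `|h|.
    rewrite rV_norm_le ?mulr_ge0//; apply/forallP => i; rewrite mxE.
    have Ni : \sum_j `|J x j i| <= N.
      by rewrite /N [leRHS](bigD1 i)//= lerDl sumr_ge0// => k _; exact: sumr_ge0.
    rewrite (le_trans (ler_norm_sum _ _ _))//.
    rewrite (le_trans _ (ler_wpM2r (normr_ge0 h) Ni))//.
    rewrite mulr_suml ler_sum// => j _; rewrite normrM mulrC ler_wpM2l//.
    exact: coord_le_norm.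
  apply: (@norm_lipschitz_continuous _ _ _ N) => y z.
  by rewrite /= -mulmxBl.
pose V : normedModType R := 'rV[R]_d.
have dvE x : (v : V -> V) \o shift x =
    cst (v x) + (mulmxr (J x) : V -> V) +o_ (0 : V) (id : V -> V).
  apply/eqaddoP => _/posnumP[e]; near=> h.
  rewrite [X in `|X|](_ : _ = v (h + x) - v x - h *m J x); last first.
    by rewrite -[LHS]/(v (h + x) - (v x + h *m J x)) opprD addrA.
  rewrite (le_trans (vD x h))// expr2 mulrA ler_wpM2r//.
  rewrite (@le_trans _ _ ((D + 1) * `|h|))//; first by rewrite ler_wpM2r// lerDl.
  have D1 : 0 < D + 1 by rewrite ltr_wpDl.
  rewrite -ler_pdivlMl//; near: h; apply: (@nbhs0_le R V).
  by rewrite mulr_gt0// invr_gt0 ltr_wpDl.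
have dv x : 'd v x = mulmxr (J x) :> (_ -> _) by exact: diff_unique (cJ x) (dvE x).
have df x : differentiable v x.
  by apply/diff_locallyP; rewrite dv; split; [exact: cJ|exact: dvE].
split => //.
have -> : (fun x => 'J v x) = J.
  apply/funext => x; apply/matrixP => i j.
  by rewrite /jacobian !mxE dv/= -rowE !mxE.
have [L LP] : {L : 'I_d * 'I_d -> R & forall ij, klipschitz `|L ij| (w' ij)}.
  apply: (@choice _ _ (fun ij (L : R) => klipschitz `|L| (w' ij))) => ij.
  by have [[L /klipschitz_ge0 wL] _] := w'P ij; exists L.
pose N := \sum_ij `|L ij|.
have N0 : 0 <= N by exact: sumr_ge0.
have NJ x y : `|J x - J y| <= N * `|x - y|.
  rewrite [leLHS]/Num.norm /= mx_normrE; apply/bigmax_leP; split => [|[i j] _ /=].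
    by rewrite mulr_ge0.
  rewrite !mxE (le_trans (LP (j, i) _ _))// ler_wpM2r// /N (bigD1 (j, i))//=.
  by rewrite lerDl sumr_ge0.
exact: norm_lipschitz_continuous NJ.
Unshelve. all: by end_near. Qed.

End coordinates.

Section shift_integrable.
Context {R : realType} {n : nat}.
Local Notation mu := (lebesgue_rV R n).

Lemma measurable_shift_rV d' (T : measurableType d') (f : 'rV[R]_n -> T)
    (h : 'rV[R]_n) :
  measurable_fun setT f -> measurable_fun setT (fun x : 'rV[R]_n => f (x + h)).
Proof. by move=> mf; exact: measurableT_comp mf (measurable_addrV h). Qed.

Lemma integrable_shift_rV (f : 'rV[R]_n -> R) (h : 'rV[R]_n) :
  mu.-integrable setT (EFin \o f) ->
  mu.-integrable setT (EFin \o (fun x => f (x + h))).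
Proof.
move=> /integrableP[mf foo]; apply/integrableP; split.
  exact: (measurable_shift_rV h mf).
have := @ge0_integral_shift_rV R n h (fun x => `|(f x)%:E|%E).
by move=> ->//; exact: measurableT_comp.
Qed.

Lemma Rintegral_shift_rV (f : 'rV[R]_n -> R) (h : 'rV[R]_n) : measurable_fun setT f ->
  \int[mu]_x f (x + h) = \int[mu]_x f x.
Proof.
move=> mf; have mf' : measurable_fun setT (EFin \o f) by exact/measurable_EFinP.
rewrite /Rintegral; congr fine; rewrite integralE [RHS]integralE; congr (_ - _)%E.
- rewrite -[RHS](ge0_integral_shift_rV h)//; last exact: measurable_funepos.
  by apply: eq_integral => x _; rewrite !funeposE.
- rewrite -[RHS](ge0_integral_shift_rV h)//; last exact: measurable_funeneg.
  by apply: eq_integral => x _; rewrite !funenegE.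
Qed.

End shift_integrable.

(** * Dyadic sums *)

Section dyadic_sums.
Context {R : realType}.
Variables (s : R).
Hypotheses (s0 : 0 < s) (s1 : s < 1).

Local Notation q := (2 `^ s).

Lemma powR2_gt1 : 1 < q.
Proof. by rewrite /powR pnatr_eq0/= expR_gt1 mulr_gt0// ln_gt0// ltr1n. Qed.

Lemma powR2_lt2 : q < 2.
Proof.
rewrite -[ltRHS]lnK ?posrE// /powR pnatr_eq0/= ltr_expR.
by rewrite gtr_pMl// ln_gt0// ltr1n. Qed.

(** The modulus of continuity, up to constants, of a function of size [2^-m] with Lipschitz constant
    1. *)
Definition dyadic_min (m : nat) (rho : R) := Num.min (2 ^- m) rho.

Lemma dyadic_min_ge0 m rho : 0 <= rho -> 0 <= dyadic_min m rho.
Proof. by move=> r0; rewrite le_min r0 invr_ge0 exprn_ge0. Qed.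

(* The sum [S M rho] satisfies [S (M + 1) rho = rho + q / 2 * S M (2 rho)] for
   [rho <= 1]. Since [q / 2 * 2 `^ (1 - s) = 1], the bound [C * rho `^ (1 - s)] alone
   is not inductive; subtracting [D * rho] with [D = 1 / (q - 1)] absorbs the term
   [rho]. *)
Lemma sum_dyadic_min : exists2 C, 0 <= C & forall M rho, 0 <= rho ->
  \sum_(m < M) q ^+ m * dyadic_min m rho <= C * rho `^ (1 - s).
Proof.
have q1 := powR2_gt1; have q2 := powR2_lt2.
have q0 : 0 < q by lra.
pose r := q / 2; have r1 : 0 < 1 - r by rewrite /r; lra.
have r0 : 0 <= r by rewrite /r; lra.
pose D := (q - 1)^-1; have D0 : 0 < D by rewrite invr_gt0; lra.
have Dq : 1 - q * D = - D.
  by rewrite /D; field; rewrite lt0r_neq0// subr_gt0.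
pose A := (1 - r)^-1; have A0 : 0 < A by rewrite invr_gt0.
have crude M rho : \sum_(m < M) q ^+ m * dyadic_min m rho <= A.
  apply: (@le_trans _ _ (\sum_(m < M) r ^+ m)).
    apply: ler_sum => m _; rewrite /r exprMn ler_pM2l ?exprn_gt0//.
    by rewrite /dyadic_min ge_min exprVn lexx.
  rewrite -(@ler_pM2l _ (1 - r))// /A mulfV ?gt_eqF//.
  by rewrite -opprB mulNr -subrX1 opprB gerBl exprn_ge0.
(* With this choice [C - D * rho >= A] for [rho < 2], so the crude geometric bound [A] settles
   [1 <= rho < 2], and the recursion is needed only for [rho < 1], whose double stays below 2. *)
pose C := A + 2 * D; have C0 : 0 < C by rewrite addr_gt0// mulr_gt0.
have s10 : 0 <= 1 - s by rewrite subr_ge0 ltW.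
have big_rho rho : 1 <= rho -> 1 <= rho `^ (1 - s).
  by move=> r1'; rewrite -[leLHS](powRr0 rho) ler_powR.
have qq : q / 2 * 2 `^ (1 - s) = 1.
  rewrite mulrAC -powRD; last by rewrite pnatr_eq0 implybT.
  by rewrite addrC subrK powRr1// divff.
have claim M rho : 0 < rho < 2 ->
    \sum_(m < M) q ^+ m * dyadic_min m rho <= C * rho `^ (1 - s) - D * rho.
  elim: M rho => [|M IH] rho /andP[rho0 rho2].
    rewrite big_ord0 subr_ge0.
    have [r1'|r1'] := leP 1 rho.
      apply: (@le_trans _ _ C); first by rewrite /C; nra.
      by rewrite ler_peMr ?big_rho// ltW.
    apply: ler_pM => //; [exact: ltW|exact: ltW|rewrite /C; nra|].
    by apply: ger1_powR; [rewrite rho0 ltW|rewrite gerBl ltW].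
  have [r1'|r1'] := leP 1 rho.
    apply: (le_trans (crude _ _)); rewrite lerBrDr.
    apply: (@le_trans _ _ C); first by rewrite /C; nra.
    by rewrite ler_peMr ?big_rho// ltW.
  rewrite big_ord_recl/= expr0 mul1r {1}/dyadic_min expr0 invr1 min_r ?(ltW r1')//.
  have -> : \sum_(i < M) q ^+ bump 0 i * dyadic_min (bump 0 i) rho =
      q / 2 * \sum_(m < M) q ^+ m * dyadic_min m (2 * rho).
    rewrite mulr_sumr; apply: eq_bigr => m _; rewrite /bump/= add1n exprS.
    have -> : dyadic_min m.+1 rho = 2^-1 * dyadic_min m (2 * rho).
      by rewrite /dyadic_min minr_pMr// mulKf// exprS invfM.
    by rewrite -!mulrA; congr (_ * _); rewrite mulrCA.
  have IH2 : \sum_(m < M) q ^+ m * dyadic_min m (2 * rho) <=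
      C * (2 * rho) `^ (1 - s) - D * (2 * rho) by apply: IH; lra.
  rewrite powRM ?(ltW rho0)// in IH2.
  have q20 : 0 <= q / 2 by rewrite divr_ge0// ltW.
  have := ler_wpM2l q20 IH2.
  have -> : q / 2 * (C * (2 `^ (1 - s) * rho `^ (1 - s)) - D * (2 * rho)) =
     C * (q / 2 * 2 `^ (1 - s)) * rho `^ (1 - s) - q * D * rho by field.
  rewrite qq mulr1 => h.
  have -> : C * rho `^ (1 - s) - D * rho =
    rho + (C * rho `^ (1 - s) - q * D * rho).
    have e : D * rho = q * D * rho - rho.
      by rewrite -[X in _ - X]mul1r -mulrBl; congr (_ * _); lra.
    by rewrite e; ring.
  by rewrite lerD2l.
exists C; first exact: ltW.
move=> M rho; rewrite le_eqVlt => /predU1P[<-|rho0].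
  rewrite big1 ?mulr_ge0 ?powR_ge0 ?(ltW C0)// => m _.
  by rewrite /dyadic_min min_r ?mulr0// invr_ge0 exprn_ge0.
have [r2|r2] := ltP rho 2.
  by rewrite (le_trans (claim M rho _)) ?rho0// gerBl mulr_ge0 ?ltW.
apply: (le_trans (crude _ _)); apply: (@le_trans _ _ C); first by rewrite /C; nra.
by rewrite ler_peMr ?big_rho ?(ltW C0)// (le_trans _ r2)// ler1n.
Qed.

Lemma sum_powR2_le (m N : nat) :
  \sum_(k < N | (k <= m)%N) q ^+ k <= q / (q - 1) * q ^+ m.
Proof.
have q1 := powR2_gt1; have q10 : 0 < q - 1 by rewrite subr_gt0.
have q0 : 0 < q by lra.
apply: (@le_trans _ _ ((q ^+ minn N m.+1 - 1) / (q - 1))).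
  elim: N => [|N IH]; first by rewrite big_ord0 min0n expr0 subrr mul0r.
  rewrite big_mkcond big_ord_recr -big_mkcond/=; case: leqP => Nm.
    move: IH; rewrite (minn_idPl (leqW Nm)) (minn_idPl _)// exprS => IH.
    have -> : (q * q ^+ N - 1) / (q - 1) = (q ^+ N - 1) / (q - 1) + q ^+ N.
      by field; rewrite gt_eqF.
    by rewrite lerD2r.
  by rewrite addr0 (minn_idPr _) ?(leqW Nm)//; move: IH; rewrite (minn_idPr _).
rewrite mulrAC ler_pM2r ?invr_gt0// -exprS.
rewrite (@le_trans _ _ (q ^+ minn N m.+1))//; first by rewrite gerBl.
by rewrite ler_weXn2l ?geq_minr// ltW.
Qed.

(** Exchanging the sums, the weights [q ^+ k] with [k <= m] add up to a multiple of [q ^+ m] because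
    [q > 1], and the single sum of [sum_dyadic_min] remains. *)
Lemma sum_sum_dyadic_min : exists2 C, 0 <= C & forall N M rho, 0 <= rho ->
  \sum_(k < N) q ^+ k * (\sum_(m < M | (k <= m)%N) dyadic_min m rho) <= C * rho `^ (1
      - s).
Proof.
have q1 := powR2_gt1; have q10 : 0 < q - 1 by rewrite subr_gt0.
have q0 : 0 < q by lra.
have [C C0 HC] := sum_dyadic_min; exists (q / (q - 1) * C).
  by rewrite mulr_ge0// divr_ge0// ltW.
move=> N M rho rho0.
under eq_bigr do rewrite mulr_sumr big_mkcond/=.
rewrite exchange_big/=.
apply: (@le_trans _ _ (\sum_(m < M) q / (q - 1) * (q ^+ m * dyadic_min m rho))).
  apply: ler_sum => m _; rewrite -big_mkcond/= -mulr_suml mulrA ler_wpM2r//.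
    exact: dyadic_min_ge0.
  exact: sum_powR2_le.
rewrite -mulr_sumr -[leRHS]mulrA ler_wpM2l ?HC//.
by rewrite divr_ge0// ltW.
Qed.

End dyadic_sums.

(** * Summing fields over dyadic scales *)

Section modulus_fields.
Context {R : realType} {d : nat}.
Implicit Types (h x y z : 'rV[R]_d) (u w g : 'rV[R]_d -> R) (i j : 'I_d).

(* The analogue of [bounded_field] with all axes, the two bounds being merged into
   one modulus of continuity that can be summed over scales. *)
Definition modulus_field (omega : R -> R) g := exists F G : 'I_d -> 'rV[R]_d -> R,
  [/\ forall i, lipschitzf (F i), forall i j, smooth_dir j (F i),
      forall i x y, `|F i x - F i y| <= omega `|x - y|,
      forall i, lipschitzf (G i) /\ pderiv (unit_rV i) (F i) (G i) &
      g = (fun x => \sum_i G i x)].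

Lemma modulus_field_of_bounded_field (B L : R) g : 0 <= L -> bounded_field (enum
    'I_d) B L g ->
  modulus_field (fun rho => Num.min (2 * B) (d%:R * L * rho)) g.
Proof.
move=> L0 [F [G [lF FB FL FG ->]]]; exists F, G; split => //.
- by move=> i j; case: (FL i j) => //; rewrite mem_enum.
- move=> i x y; rewrite le_min; apply/andP; split.
    by rewrite (le_trans (ler_normB _ _))// mulrDl mul1r lerD.
  by apply: dirlipschitz_klipschitz => // j; case: (FL i j) => //; rewrite mem_enum.
Qed.

Lemma modulus_fieldW (o1 o2 : R -> R) g : (forall rho, 0 <= rho -> o1 rho <= o2 rho) ->
  modulus_field o1 g -> modulus_field o2 g.
Proof.
move=> o12 [F [G [lF sF FB FG ->]]]; exists F, G; split => // i x y.
by rewrite (le_trans (FB _ _ _))// o12.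
Qed.

Lemma modulus_fieldD (o1 o2 : R -> R) g1 g2 : modulus_field o1 g1 -> modulus_field o2
    g2 ->
  modulus_field (fun rho => o1 rho + o2 rho) (fun x => g1 x + g2 x).
Proof.
move=> [F1 [G1 [lF1 sF1 FB1 FG1 ->]]] [F2 [G2 [lF2 sF2 FB2 FG2 ->]]].
exists (fun i x => F1 i x + F2 i x), (fun i x => G1 i x + G2 i x); split.
- by move=> i; exact: lipschitzfD.
- by move=> i j; exact: smooth_dirD.
- move=> i x y; rewrite opprD addrACA (le_trans (ler_normD _ _))//.
  by rewrite lerD.
- move=> i; have [? ?] := FG1 i; have [? ?] := FG2 i.
  by split; [exact: lipschitzfD|exact: pderivD].
- by apply/funext => x; rewrite big_split.
Qed.

Lemma modulus_fieldZ (a : R) (o : R -> R) g : 0 <= a -> modulus_field o g ->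
  modulus_field (fun rho => a * o rho) (fun x => a * g x).
Proof.
move=> a0 [F [G [lF sF FB FG ->]]].
exists (fun i x => a * F i x), (fun i x => a * G i x); split.
- by move=> i; exact: lipschitzfZ.
- by move=> i j; exact: smooth_dirZ.
- by move=> i x y; rewrite -mulrBr normrM ger0_norm// ler_wpM2l.
- by move=> i; have [? ?] := FG i; split; [exact: lipschitzfZ|exact: pderivZ].
- by apply/funext => x; rewrite mulr_sumr.
Qed.

Lemma modulus_field0 : modulus_field (cst 0) (cst 0).
Proof.
exists (fun=> cst 0), (fun=> cst 0); split => //.
- by move=> i; exact: lipschitzf0.
- by move=> i j; exact: smooth_dir0.
- by move=> i x y; rewrite subrr normr0.
- by move=> i; split; [exact: lipschitzf0|exact: pderiv0].
- by apply/funext => x; rewrite big1.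
Qed.

Lemma modulus_field_sum (N : nat) (o : nat -> R -> R) (g : nat -> 'rV[R]_d -> R) :
  (forall k, (k < N)%N -> modulus_field (o k) (g k)) ->
  modulus_field (fun rho => \sum_(k < N) o k rho) (fun x => \sum_(k < N) g k x).
Proof.
elim: N => [|N IH] H.
  rewrite (_ : (fun rho => _) = cst 0); last by apply/funext => x; rewrite big_ord0.
  rewrite (_ : (fun x => _) = cst 0); last by apply/funext => x; rewrite big_ord0.
  exact: modulus_field0.
rewrite (_ : (fun rho => _) = (fun rho => \sum_(k < N) o k rho + o N rho)); last first.
  by apply/funext => x; rewrite big_ord_recr.
rewrite (_ : (fun x => _) = (fun x => \sum_(k < N) g k x + g N x)); last first.
  by apply/funext => x; rewrite big_ord_recr.
by apply: modulus_fieldD; [apply: IH => k kN; exact: H (ltnW kN)|exact: H].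
Qed.

Definition smooth_at m u := avgs (2 ^- m) (enum 'I_d) u.

Let pow2_gt0 m : 0 < 2 ^- m :> R.
Proof. by rewrite invr_gt0 exprn_gt0. Qed.

(** Neither the Lipschitz constant of [u] nor the value of [t] enters the bound. At the coarsest
    scale [k], [|t| <= 2^-k] gives a field of size [2^-k] with directional Lipschitz constants at
    most 2; each further halving adds one scale. In [d ^+ 2] one factor counts the axes halved in
    turn, the other the axes walked along between two points. *)
Lemma modulus_field_smooth_at_diff i (t : R) k M u : (0 < d)%N -> lipschitzf u ->
  (forall x, `|u x| <= 1) -> `|t| <= 2 ^- k ->
  modulus_field (fun rho => 2 * d%:R ^+ 2 *
      (dyadic_min k rho + \sum_(k <= m < k + M) dyadic_min m rho))
    (fun x => smooth_at (k + M) u (x + t *: unit_rV i) - smooth_at (k + M) u x).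
Proof.
move=> d0 lu u1 tk; have d1 : 1 <= d%:R :> R by rewrite ler1n.
have dd : d%:R <= d%:R ^+ 2 :> R by rewrite expr2 ler_peMl.
elim: M => [|M IH].
  rewrite addn0; have := @bounded_field_diff _ _ (enum 'I_d) i t 1 (2 * 1 / 2 ^- k)
    (smooth_at k u) (avgs_lipschitzf _ _ lu) (avgs_bound _ _ lu u1)
    (avgs_smooth (pow2_gt0 k) lu u1) ler01.
  have L0 : 0 <= 2 * 1 / (2 ^- k) :> R by rewrite divr_ge0// ltW.
  move=> /(_ L0); move/modulus_field_of_bounded_field => H.
  apply: modulus_fieldW (H _); last by rewrite mulr_ge0.
  move=> rho rho0; rewrite big_geq// addr0 /dyadic_min minr_pMr; last first.
    by rewrite mulr_ge0// exprn_ge0.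
  have d21 : 1 <= d%:R ^+ 2 :> R by exact: le_trans d1 dd.
  rewrite !mulr1; apply: le_min2.
    rewrite -mulrA ler_pM2l// (le_trans tk)// ler_peMl// ltW//.
  have tk2 : `|t| * (2 / 2 ^- k) <= 2.
    rewrite mulrCA -[leRHS]mulr1 ler_pM2l//.
    by rewrite ler_pdivrMr ?pow2_gt0// mul1r.
  rewrite ler_wpM2r// mulrC; apply: ler_pM => //.
(* At the finer scales the translation difference is treated as a mere bounded function: the halving
   of the cube alone produces the divergence. *)
pose w x := u (x + t *: unit_rV i) - u x.
have lw : lipschitzf w by apply: lipschitzfB => //; exact: lipschitzf_shift.
have w2 x : `|w x| <= 2.
  by rewrite (le_trans (ler_normB _ _))// -[2]/(1 + 1) lerD.
have h2 : 2 ^- (k + M) = 2 * 2 ^- (k + M).+1 :> R.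
  by rewrite exprS invfM mulrA mulfV ?mul1r// pnatr_eq0.
have := bounded_field_halve (enum 'I_d) (pow2_gt0 (k + M).+1) (ler0n R 2) lw w2.
rewrite -h2 => /modulus_field_of_bounded_field H.
have L0 : 0 <= (size (enum 'I_d))%:R * 2 :> R by rewrite mulr_ge0.
have E x : smooth_at (k + M.+1) u (x + t *: unit_rV i) - smooth_at (k + M.+1) u x =
  (smooth_at (k + M) u (x + t *: unit_rV i) - smooth_at (k + M) u x) +
  (avgs (2 ^- (k + M).+1) (enum 'I_d) w x - avgs (2 ^- (k + M)) (enum 'I_d) w x).
  rewrite /w !avgsB//; try exact: lipschitzf_shift.
  rewrite !avgs_shift /smooth_at addnS.
  move: (avgs _ _ u (x + _)) (avgs _ _ u x) (avgs (2 ^- (k + M)) _ u _) (avgs (2 ^-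
      (k + M)) _ u x).
  by move=> a b e f; ring.
rewrite (funext E).
apply: modulus_fieldW (modulus_fieldD IH (H L0)) => rho rho0.
rewrite addnS big_nat_recr/= ?leq_addr// addrA [leRHS]mulrDr lerD2l.
rewrite /dyadic_min minr_pMr; last by rewrite mulr_ge0// exprn_ge0.
rewrite size_enum_ord h2; have := pow2_gt0 (k + M).+1; move: (2 ^- _) => c c0.
apply: le_min2; first by nra.
by rewrite ler_wpM2r//; nra.
Qed.

End modulus_fields.

(** * From the dual supremum to dyadic sums of differences *)

Section dual_bound.
Context {R : realType} {d : nat}.
Implicit Types (h x y z : 'rV[R]_d) (f u w g : 'rV[R]_d -> R) (i j : 'I_d).
Local Notation mu := (lebesgue_rV R d).

(** The factor [d^-1] pays for replacing the sup norm of [v x - v y] by its Euclidean norm; on the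
    side of [x - y] the sup norm is already the smaller one. *)
Lemma modulus_field_admissible (a : R) g : 0 <= a -> (0 < d)%N ->
  modulus_field (fun rho => d%:R^-1 * rho `^ a) g ->
  exists v, [/\ C1 v, (holder_const a v <= 1)%E & divergence v = g].
Proof.
move=> a0 d0 [F [G [lF sF FB FG gE]]].
have d0' : 0 < d%:R :> R by rewrite ltr0n.
exists (fun x => \row_i F i x); split; first exact: C1_of_smooth.
- apply: ge_ereal_sup => _ [[x y] /= xy <-].
  have xy0 : 0 < enorm (x - y) by apply: enorm_gt0; rewrite subr_eq0; apply/eqP.
  rewrite lee_fin ler_pdivrMr ?powR_gt0// mul1r.
  apply: (le_trans (enorm_le_norm _)); rewrite -ler_pdivlMl//.
  apply: (@le_trans _ _ (d%:R^-1 * `|x - y| `^ a)).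
    rewrite rV_norm_le ?mulr_ge0 ?invr_ge0 ?powR_ge0//.
    by apply/forallP => i; rewrite !mxE.
  rewrite ler_wpM2l ?invr_ge0//.
  by apply: ge0_ler_powR; rewrite ?nnegrE ?enorm_ge0// norm_le_enorm.
- apply/funext => x; rewrite gE; apply: eq_bigr => i _.
  have -> : (fun y => (\row_i0 F i0 y) ord0 i) = F i by apply/funext => y; rewrite mxE.
  by case: (FG i) => _ /pderiv_derive.
Qed.

(** The Lipschitz sign keeps half of the norm and the averaging may lose another quarter. The number
    [M] of halvings depends on the Lipschitz constant of [sigma], hence differs from one [phi] to
    the next. *)
Lemma smooth_at_sign (phi : 'rV[R]_d -> R) k :
  mu.-integrable setT (EFin \o phi) ->
  exists sigma M, [/\ lipschitzf sigma, forall x, `|sigma x| <= 1 &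
    (\int[mu]_x `|phi x|) / 4 <= \int[mu]_x (phi x * smooth_at (k + M) sigma x)].
Proof.
move=> iphi; have [sigma [ls s1 Hs]] := exists_lipschitz_sign iphi.
have [K sK] := ls.
set N := \int[mu]_x `|phi x| in Hs *.
have N0 : 0 <= N by exact: Rintegral_ge0.
have [M HM] : exists M, d%:R * (`|K| * 2 ^- (k + M)) <= 4^-1.
  have Kd : 0 <= 4 * (d%:R * `|K|) by rewrite !mulr_ge0.
  (* Since [2 ^+ (k + M)] is at least [M], it exceeds [4 * d * |K|], which is the fineness asked
     for. *)
  pose M := (Num.truncn (4 * (d%:R * `|K|))).+1; exists M.
  have h1 : 4 * (d%:R * `|K|) < M%:R by exact: truncnS_gt.
  have h2 : M%:R <= 2 ^+ (k + M) :> R.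
    rewrite -natrX ler_nat (leq_trans (ltnW (ltn_expl M (ltnSn 1))))//.
    by rewrite leq_exp2l// leq_addl.
  rewrite mulrA ler_pdivrMr ?exprn_gt0//.
  by rewrite ler_pdivlMl//; exact: le_trans (ltW h1) h2.
exists sigma, M; split => //.
have lP : lipschitzf (smooth_at (k + M) sigma) by exact: avgs_lipschitzf.
have mP : measurable_fun setT (smooth_at (k + M) sigma).
  by case: lP => L; exact: klipschitz_measurable.
have ms : measurable_fun setT sigma by exact: klipschitz_measurable sK.
have i1 : mu.-integrable setT (EFin \o (fun x => phi x * sigma x)).
  by apply: (@integrable_mulr_bounded _ _ _ _ _ _ 1) => //; apply: aeW => x _.
have i2 : mu.-integrable setT (EFin \o (fun x => phi x * smooth_at (k + M) sigma x)).
  apply: (@integrable_mulr_bounded _ _ _ _ _ _ 1) => //; apply: aeW => x _.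
  exact: avgs_bound.
have PB x : `|smooth_at (k + M) sigma x - sigma x| <= 4^-1.
  rewrite (le_trans (avgs_near _ _ sK x))// size_enum_ord.
  by rewrite (@ger0_norm _ (2 ^- (k + M)))// invr_ge0 exprn_ge0.
have := ler_norm_Rintegral_mulr iphi (measurable_funB mP ms) PB.
rewrite (_ : \int[mu]_x (phi x * (_ \- _) x) =
  \int[mu]_x (phi x * smooth_at (k + M) sigma x) - \int[mu]_x (phi x * sigma x));
      last first.
  by rewrite -RintegralB//; apply: eq_Rintegral => x _; rewrite /= mulrBr.
rewrite ler_norml -/N => /andP[? _]; lra.
Qed.

Lemma Rintegral_diff_mulr f h w (B : R) : mu.-integrable setT (EFin \o f) ->
  measurable_fun setT w -> (forall x, `|w x| <= B) ->
  \int[mu]_x ((f (x + h) - f x) * w x) = \int[mu]_x (f x * (w (x - h) - w x)).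
Proof.
move=> f1 mw wB; have f1h := integrable_shift_rV h f1.
have mwh : measurable_fun setT (fun x => w (x - h)) by exact: measurable_shift_rV.
have i1 : mu.-integrable setT (EFin \o (fun x => f x * w x)).
  by apply: (@integrable_mulr_bounded _ _ _ _ _ _ B) => //; apply: aeW => x _.
have i2 : mu.-integrable setT (EFin \o (fun x => f (x + h) * w x)).
  by apply: (@integrable_mulr_bounded _ _ _ _ _ _ B) => //; apply: aeW => x _.
have i3 : mu.-integrable setT (EFin \o (fun x => f x * w (x - h))).
  by apply: (@integrable_mulr_bounded _ _ _ _ _ _ B) => //; apply: aeW => x _.
transitivity (\int[mu]_x (f (x + h) * w x) - \int[mu]_x (f x * w x)).
  by rewrite -RintegralB//; apply: eq_Rintegral => x _; rewrite mulrBl.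
transitivity (\int[mu]_x (f x * w (x - h)) - \int[mu]_x (f x * w x)); last first.
  by rewrite -RintegralB//; apply: eq_Rintegral => x _; rewrite mulrBr.
congr (_ - _); rewrite -[RHS](Rintegral_shift_rV h).
  by apply: eq_Rintegral => x _; rewrite addrK.
by apply/measurable_EFinP; exact: measurable_int i3.
Qed.

Lemma Rintegral_sum_mulr f (N : nat) (g : nat -> 'rV[R]_d -> R) (c : nat -> R) (B : R) :
  mu.-integrable setT (EFin \o f) ->
  (forall k, measurable_fun setT (g k)) -> (forall k x, `|g k x| <= B) ->
  mu.-integrable setT (EFin \o (fun x => f x * \sum_(k < N) c k * g k x)) /\
  \int[mu]_x (f x * \sum_(k < N) c k * g k x) = \sum_(k < N) c k * \int[mu]_x (f x *
      g k x).
Proof.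
move=> f1 mg gB; have i1 k : mu.-integrable setT (EFin \o (fun x => f x * g k x)).
  by apply: (@integrable_mulr_bounded _ _ _ _ _ _ B) => //; apply: aeW => x _.
elim: N => [|N [IH1 IH2]].
  rewrite big_ord0 (_ : (fun x => _) = cst 0); last first.
    by apply/funext => x; rewrite big_ord0 mulr0.
  by split; [exact: integrable0|rewrite Rintegral_cst// mul0r].
rewrite (_ : (fun x => f x * \sum_(k < N.+1) c k * g k x) =
   (fun x => f x * (\sum_(k < N) c k * g k x) + c N * (f x * g N x))); last first.
  by apply/funext => x; rewrite big_ord_recr/= mulrDr mulrCA.
have i2 := integrable_EFinZl (c N) (i1 N).
split; first exact: integrable_EFinD.
by rewrite RintegralD// IH2 big_ord_recr/= RintegralZl.
Qed.

Variables (s : R).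
Hypotheses (s0 : 0 < s) (s1 : s < 1) (d0 : (0 < d)%N).

Lemma sum_diff_le_dual f (S : R) :
  mu.-integrable setT (EFin \o f) ->
  (forall v, C1 v -> (holder_const (1 - s) v <= 1)%E ->
    \int[mu]_x (f x * divergence v x) <= S) ->
  exists C, forall N i (t : nat -> R), (forall k, `|t k| <= 2 ^- k) ->
    \sum_(k < N) (2 `^ s) ^+ k * \int[mu]_x `|f (x + t k *: unit_rV i) - f x| <= C.
Proof.
move=> f1 fS; set q := 2 `^ s.
have q0 : 0 < q by rewrite powR_gt0.
have [C C0 HC] := sum_sum_dyadic_min s0 s1.
have d0' : 0 < d%:R :> R by rewrite ltr0n.
(* Dividing the field by [D] makes it admissible: [d] produces the factor [d^-1] of
   [modulus_field_admissible], [4 * d ^+ 2 * C] is the constant of the summed modulus, and [1] keeps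
   [D] positive when [C = 0]. *)
pose D := d%:R * (4 * d%:R ^+ 2 * C + 1).
have D0 : 0 < D by rewrite mulr_gt0// ltr_wpDl// !mulr_ge0// exprn_ge0.
(* The [4] is the loss in [smooth_at_sign], and [D] undoes the normalisation of the field. *)
exists (4 * D * S) => N i t tk.
pose phi k x := f (x + t k *: unit_rV i) - f x.
have iphi k : mu.-integrable setT (EFin \o phi k).
  by apply: integrable_EFinB => //; exact: integrable_shift_rV.
have /choice[sM sMP] : forall k, exists sM : ('rV[R]_d -> R) * nat,
  [/\ lipschitzf sM.1, forall x, `|sM.1 x| <= 1 &
    (\int[mu]_x `|phi k x|) / 4 <= \int[mu]_x (phi k x * smooth_at (k + sM.2) sM.1 x)].
  by move=> k; have [sg [M H]] := smooth_at_sign k (iphi k); exists (sg, M).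
pose w k := smooth_at (k + (sM k).2) (sM k).1.
have lw k : lipschitzf (w k) by case: (sMP k) => ? _ _; exact: avgs_lipschitzf.
have mw k : measurable_fun setT (w k) by case: (lw k) => K; exact: klipschitz_measurable.
have w1 k x : `|w k x| <= 1 by case: (sMP k) => ? ? _; exact: avgs_bound.
(* The sign of the step is reversed because the translation is moved from [f] to [w k]. *)
pose g k x := w k (x + (- t k) *: unit_rV i) - w k x.
have mg k : measurable_fun setT (g k).
  by apply: measurable_funB => //; exact: measurable_shift_rV.
have g2 k x : `|g k x| <= 2.
  by rewrite (le_trans (ler_normB _ _))// -[2]/(1 + 1) lerD.
(* A common cutoff above every finest scale [k + (sM k).2], so that all inner sums extend to the
   same range, as the double sum requires. *)
pose M := \sum_(k < N) (k + (sM k).2)%N.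
have mf : modulus_field (fun rho => d%:R^-1 * rho `^ (1 - s))
    (fun x => \sum_(k < N) (D^-1 * q ^+ k) * g k x).
  have H k : (k < N)%N -> modulus_field
      (fun rho => D^-1 * q ^+ k * (4 * d%:R ^+ 2 * \sum_(m < M.+1 | (k <= m)%N)
          dyadic_min m rho))
      (fun x => (D^-1 * q ^+ k) * g k x).
    move=> kN; have Dq : 0 <= D^-1 * q ^+ k.
      by rewrite mulr_ge0 ?invr_ge0 ?exprn_ge0 ?ltW.
    apply: modulus_fieldZ => //; case: (sMP k) => ls sg1 _.
    have tk' : `|- t k| <= 2 ^- k by rewrite normrN.
    apply: modulus_fieldW (modulus_field_smooth_at_diff i (sM k).2 d0 ls sg1 tk') =>
        rho rho0.
    have kM : (k + (sM k).2 <= M)%N by rewrite /M (bigD1 (Ordinal kN))//= leq_addr.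
    have e1 : dyadic_min k rho <= \sum_(m < M.+1 | (k <= m)%N) dyadic_min m rho.
      have kM1 : (k < M.+1)%N by rewrite ltnS (leq_trans _ kM)// leq_addr.
      rewrite (bigD1 (Ordinal kM1))//= lerDl; apply: sumr_ge0 => m _.
      exact: dyadic_min_ge0.
    have e2 : \sum_(k <= m < k + (sM k).2) dyadic_min m rho <= \sum_(m < M.+1 | (k <=
        m)%N) dyadic_min m rho.
      rewrite -(big_mkord (fun m => (k <= m)%N) (fun m => dyadic_min m rho)).
      rewrite [leRHS](@big_cat_nat _ _ _ (k + (sM k).2)%N)//=; last exact: leqW.
      rewrite -[leLHS]addr0 lerD//; last by apply: sumr_ge0 => m _; exact: dyadic_min_ge0.
      rewrite [leRHS](@big_cat_nat _ _ _ k)//= ?leq_addr//.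
      rewrite -[leLHS]add0r lerD//; first by apply: sumr_ge0 => m _; exact:
          dyadic_min_ge0.
      rewrite [leRHS]big_nat_cond [leLHS]big_nat_cond le_eqVlt; apply/orP; left.
      apply/eqP; apply: eq_bigl => m; rewrite andbT; case: (leqP k m) => //=.
      by rewrite andbT.
    rewrite (_ : 4 * _ * _ = 2 * d%:R ^+ 2 * (\sum_(m < M.+1 | (k <= m)%N) dyadic_min
        m rho +
      \sum_(m < M.+1 | (k <= m)%N) dyadic_min m rho)); last by ring.
    by rewrite ler_wpM2l ?lerD// mulr_ge0// exprn_ge0.
  apply: modulus_fieldW (modulus_field_sum H) => rho rho0.
  have := HC N M.+1 rho rho0.
  rewrite (_ : \sum_(k < N) D^-1 * _ * _ = D^-1 * (4 * d%:R ^+ 2) *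
    (\sum_(k < N) q ^+ k * \sum_(m < M.+1 | (k <= m)%N) dyadic_min m rho)); last first.
    rewrite mulr_sumr; apply: eq_bigr => k _.
    move: D^-1 (q ^+ k) (4 * _) (\sum_(m < _ | _) _) => a b c e; ring.
  move=> HC1; have DD : 0 <= D^-1 * (4 * d%:R ^+ 2).
    by rewrite mulr_ge0 ?invr_ge0 ?(ltW D0)// mulr_ge0// exprn_ge0.
  rewrite (le_trans (ler_wpM2l DD HC1))// (mulrA _ C) ler_wpM2r ?powR_ge0//.
  rewrite -mulrA mulrC ler_pdivrMr// /D mulKf ?gt_eqF//.
  by rewrite lerDl.
have s10 : 0 <= 1 - s by rewrite subr_ge0 ltW.
have [v [v1 v2 v3]] := modulus_field_admissible s10 d0 mf.
have := fS v v1 v2; rewrite v3.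
have [_ ->] := Rintegral_sum_mulr N (fun k => D^-1 * q ^+ k) f1 mg g2.
move=> HS; rewrite -mulrA -ler_pdivrMl// -ler_pdivrMl//.
apply: le_trans HS; rewrite !mulr_sumr; apply: ler_sum => k _.
rewrite -!mulrA ler_wpM2l ?invr_ge0 ?(ltW D0)// mulrCA ler_wpM2l ?exprn_ge0 ?(ltW q0)//.
case: (sMP k) => _ _; rewrite mulrC => /le_trans; apply.
rewrite /phi (Rintegral_diff_mulr _ f1 (mw k) (w1 k)).
rewrite le_eqVlt; apply/orP; left; apply/eqP; apply: eq_Rintegral => x _.
by rewrite /g scaleNr.
Qed.

End dual_bound.

(** * Difference quotients of admissible fields *)

Section forward.
Context {R : realType} {d : nat}.
Implicit Types (h x y z : 'rV[R]_d) (f u w g : 'rV[R]_d -> R) (i j : 'I_d).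
Local Notation mu := (lebesgue_rV R d).

Lemma continuous_bounded_ball g (r : R) : continuous g ->
  exists B, forall x, `|x| <= r -> `|g x| <= B.
Proof.
move=> cg; pose K := [set x : 'rV[R]_d | forall i, `[- r, r]%classic (x ord0 i)].
have cK : compact K.
  apply: (@rV_compact _ _ (fun=> `[- r, r]%classic)) => i.
  exact: segment_compact.
have cgK : compact (g @` K).
  by apply: continuous_compact => //; exact: continuous_subspaceT.
have [M [Mreal HM]] := compact_bounded cgK.
exists (M + 1) => x xr; apply: (HM (M + 1)); first by rewrite ltrDl.
exists x => // i; rewrite /= in_itv/= -ler_norml.
exact: le_trans (coord_le_norm x i) xr.
Qed.

Lemma enormZ (a : R) x : enorm (a *: x) = `|a| * enorm x.
Proof.
rewrite /enorm -sqrtr_sqr -sqrtrM ?sqr_ge0// mulr_sumr; congr Num.sqrt.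
by apply: eq_bigr => i _; rewrite mxE exprMn.
Qed.

Lemma enorm_unit_rV i : enorm (unit_rV i : 'rV[R]_d) = 1.
Proof.
rewrite /enorm (bigD1 i)//= mxE !eqxx expr1n big1 ?addr0 ?sqrtr1// => j ji.
by rewrite mxE eqxx (negbTE ji) expr0n.
Qed.

Section component.
Variables (v : 'rV[R]_d -> 'rV[R]_d) (i : 'I_d).
Hypothesis C1v : C1 v.

Let w x := v x ord0 i.
Let w' x := 'D_(unit_rV i) w x.

Lemma C1_derivable x : derivable w x (unit_rV i).
Proof.
have [dv _] := C1v; have := diff_derivable (v := unit_rV i) (dv x).
by move=> /derivable_mxP; exact.
Qed.

Lemma C1_partial_continuous : continuous w'.
Proof.
have [dv cJ] := C1v.
have -> : w' = (fun M : 'M[R]_d => M i i) \o (fun x => 'J v x).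
  apply/funext => x; have h := diff_derivable (v := unit_rV i) (dv x).
  have := derive_mx h; rewrite deriveEjacobian// => /matrixP/(_ ord0 i).
  by rewrite /unit_rV -rowE !mxE /w' /= /jacobian mxE /unit_rV => <-.
by move=> x; apply: continuous_comp; [exact: cJ|exact: coord_continuous].
Qed.

Lemma line_is_derive x (r : R) : is_derive r 1 (fun t : R => w (x + t *: unit_rV i))
    (w' (x + r *: unit_rV i)).
Proof.
have dw := @C1_derivable (x + r *: unit_rV i).
have E : (fun h : R => h^-1 *: (((fun t : R => w (x + t *: unit_rV i)) \o shift r) (h
    *: 1) - w (x + r *: unit_rV i)))
   = (fun h : R => h^-1 *: ((w \o shift (x + r *: unit_rV i)) (h *: unit_rV i) - w (x
       + r *: unit_rV i))).
  apply/funext => h; congr (_ *: (_ - _)); rewrite /= /shift/=.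
  by rewrite [h *: 1]mulr1 scalerDl addrCA.
by apply: DeriveDef; rewrite /derivable/derive E.
Qed.

Lemma component_MVT x (r : R) : 0 <= r ->
  exists2 c, 0 <= c <= r & w (x + r *: unit_rV i) - w x = w' (x + c *: unit_rV i) * r.
Proof.
move=> r0; have [|c|c] := @MVT_segment R (fun t => w (x + t *: unit_rV i)) (fun t =>
    w' (x + t *: unit_rV i)) 0 r r0.
- by move=> t _; exact: line_is_derive.
- by apply: derivable_within_continuous => t _; apply: ex_derive; exact: line_is_derive.
rewrite in_itv/= scale0r addr0 subr0 => cr E; by exists c.
Qed.

Definition dyadic_quot k x := 2 ^+ k * (w (x + 2 ^- k *: unit_rV i) - w x).

Lemma dyadic_quot_cvg x : dyadic_quot k x @[k --> \oo] --> w' x.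
Proof.
have /cvg_dnbhs_at_right/cvg_at_rightP/(_ (fun k => 2 ^- k)) H := @C1_derivable x.
have v0 : (fun k : nat => 2 ^- k : R) @ \oo --> (0 : R).
  rewrite (_ : (fun k => _) = GRing.exp 2^-1); last first.
    by apply/funext => k; rewrite exprVn.
  by apply: cvg_expr; rewrite ger0_norm// invf_lt1// ltr1n.
have pos (n : nat) : 0 < 2 ^- n :> R by rewrite invr_gt0 exprn_gt0.
rewrite (_ : dyadic_quot ^~ x =
  fun n : nat => (2 ^- n)^-1 *: ((w \o shift x) (2 ^- n *: unit_rV i) - w x)).
  exact: H (conj pos v0).
by apply/funext => n; rewrite /dyadic_quot invrK (addrC x).
Qed.

(** This bound is uniform in [k] and serves as domination; the Hoelder bound grows with [k]. The
    radius increases by 1 because the step [2^-k] is at most 1. *)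
Lemma dyadic_quot_bound x k (B : R) : (forall y, `|y| <= `|x| + 1 -> `|w' y| <= B) ->
  `|dyadic_quot k x| <= B.
Proof.
move=> wB; have pos : 0 < 2 ^- k :> R by rewrite invr_gt0 exprn_gt0.
have [c /andP[c0 ck] E] := @component_MVT x _ (ltW pos).
rewrite /dyadic_quot E mulrCA mulfV ?expf_neq0// mulr1.
apply: wB; rewrite (le_trans (ler_normD _ _))// lerD2l normrZ norm_unit_rV mulr1.
rewrite ger0_norm// (le_trans ck)// invf_le1 ?exprn_gt0//.
by rewrite exprn_ege1// ler1n.
Qed.

Lemma dyadic_quot_holder (s : R) k x : 0 < s < 1 -> (holder_const (1 - s) v <= 1)%E ->
  `|dyadic_quot k x| <= (2 `^ s) ^+ k.
Proof.
move=> /andP[s0 s1] hv; have pos : 0 < 2 ^- k :> R by rewrite invr_gt0 exprn_gt0.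
set y := x + 2 ^- k *: unit_rV i.
have yx : y - x = 2 ^- k *: unit_rV i by rewrite /y addrAC subrr add0r.
have eyx : enorm (y - x) = 2 ^- k by rewrite yx enormZ enorm_unit_rV mulr1 gtr0_norm.
have neyx : y <> x.
  move=> E; move: eyx; rewrite E subrr enorm0 => h0.
  by move: pos; rewrite -h0 ltxx.
have hle : enorm (v y - v x) <= (2 ^- k) `^ (1 - s).
  have : ((enorm (v y - v x) / enorm (y - x) `^ (1 - s))%:E <= 1)%E.
    by apply: (le_trans _ hv); apply: ereal_sup_ubound; exists (y, x).
  by rewrite lee_fin eyx ler_pdivrMr ?powR_gt0// mul1r.
rewrite /dyadic_quot normrM ger0_norm ?exprn_ge0// -/y.
apply: (@le_trans _ _ (2 ^+ k * (2 ^- k) `^ (1 - s))).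
  rewrite ler_wpM2l ?exprn_ge0// (le_trans _ hle)// (le_trans _ (norm_le_enorm _))//.
  by have := coord_le_norm (v y - v x) i; rewrite !mxE.
rewrite -!powR_mulrn ?powR_ge0// -powRN -!powRrM -powRD; last by rewrite pnatr_eq0
    implybT.
by rewrite le_eqVlt; apply/orP; left; apply/eqP; congr (_ `^ _); ring.
Qed.

Lemma dyadic_quot_double x k : dyadic_quot k x =
  (dyadic_quot k.+1 x + dyadic_quot k.+1 (x + 2 ^- k.+1 *: unit_rV i)) / 2.
Proof.
rewrite /dyadic_quot -[x + 2 ^- k.+1 *: unit_rV i + _]addrA -scalerDl.
have -> : 2 ^- k.+1 + 2 ^- k.+1 = 2 ^- k :> R.
  by rewrite exprS; field; rewrite expf_neq0 ?pnatr_eq0.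
by rewrite exprS; field.
Qed.

Lemma dyadic_quot_continuous k : continuous (dyadic_quot k).
Proof.
have cw : continuous w.
  have [dv _] := C1v; move=> x.
  apply: (@continuous_comp _ _ _ v (fun M : 'rV[R]_d => M ord0 i)).
    by move=> A; exact: differentiable_continuous (dv x) A.
  exact: coord_continuous.
have cs : continuous (fun x => x + 2 ^- k *: unit_rV i).
  apply: (@norm_lipschitz_continuous _ _ _ 1) => x y.
  by rewrite mul1r opprD addrACA subrr addr0.
have cws : continuous (fun x => w (x + 2 ^- k *: unit_rV i)).
  move=> x; apply: (@continuous_comp _ _ _ (fun x => x + 2 ^- k *: unit_rV i) w).
    exact: cs.
  exact: cw.
move=> x; apply: (@continuousM R _ (cst (2 ^+ k)) (fun x => w (x + 2 ^- k *: unit_rV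
    i) - w x)).
  exact: cst_continuous.
by apply: (@continuousB R R^o _ (fun x => w (x + 2 ^- k *: unit_rV i)) w); [exact:
    cws|exact: cw].
Qed.

End component.
Lemma measurable_dyadic_quot v i k : C1 v -> measurable_fun setT (dyadic_quot v i k).
Proof.
by move=> C1v; apply: continuous_measurable_fun_rV; exact: dyadic_quot_continuous.
Qed.

Lemma Rintegral_dyadic_quot_le f v i (s : R) N : 0 < s < 1 ->
  mu.-integrable setT (EFin \o f) -> C1 v -> (holder_const (1 - s) v <= 1)%E ->
  \int[mu]_x (f x * dyadic_quot v i N x) <= \int[mu]_x `|f x| +
    \sum_(k < N.+1) (2 `^ s) ^+ k * \int[mu]_x `|f (x + (- 2 ^- k) *: unit_rV i) - f x|.
Proof.
move=> s01 f1 C1v hv; set q := 2 `^ s.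
have q0 : 0 <= q by exact: powR_ge0.
have dqB k x : `|dyadic_quot v i k x| <= q ^+ k by exact: dyadic_quot_holder.
have mq k := measurable_dyadic_quot i k C1v.
have D0 k : 0 <= \int[mu]_x `|f (x + (- 2 ^- k) *: unit_rV i) - f x|.
  by exact: Rintegral_ge0.
elim: N => [|N IH].
  (* The first quotient is bounded by [q ^+ 0 = 1], which gives the norm of [f]; the summand [k = 0]
     is a nonnegative extra that lets the sum start at zero. *)
  have := ler_norm_Rintegral_mulr f1 (mq 0%N) (dqB 0%N).
  rewrite expr0 mul1r => /(le_trans (ler_norm _)) /le_trans; apply.
  by rewrite big_ord_recl big_ord0 addr0 lerDl mulr_ge0// exprn_ge0.
rewrite big_ord_recr addrA -lerBlDl.
(* The step is negative since moving the translation from the quotient to [f] reverses it. *)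
set a := - 2 ^- N.+1; pose dN x := f (x + a *: unit_rV i) - f x.
have idN : mu.-integrable setT (EFin \o dN).
  by apply: integrable_EFinB => //; exact: integrable_shift_rV.
have ifq k : mu.-integrable setT (EFin \o (fun x => f x * dyadic_quot v i k x)).
  by apply: (@integrable_mulr_bounded _ _ _ _ _ _ (q ^+ k)) => //; apply: aeW => x _.
have E : \int[mu]_x (dN x * dyadic_quot v i N.+1 x) =
    2 * (\int[mu]_x (f x * dyadic_quot v i N x) - \int[mu]_x (f x * dyadic_quot v i
        N.+1 x)).
  rewrite -RintegralB// -RintegralZl//; last exact: integrable_EFinB.
  rewrite (Rintegral_diff_mulr _ f1 (mq N.+1) (dqB N.+1)).
  apply: eq_Rintegral => x _; rewrite [dyadic_quot v i N x]dyadic_quot_double /a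
      scaleNr opprK.
  by move: (dyadic_quot v i N.+1 x) (dyadic_quot v i N.+1 _) => b c; field.
have := ler_norm_Rintegral_mulr idN (mq N.+1) (dqB N.+1).
rewrite E ler_norml -/dN => /andP[lo _].
(* The telescoping yields only half of this term; its sign allows the factor to be dropped. *)
have : 0 <= q ^+ N.+1 * \int[mu]_x `|dN x|.
  by apply: mulr_ge0; [exact: exprn_ge0|exact: D0].
move: lo IH; rewrite /= -/dN; lra.
Qed.

Lemma partial_mulr_le f v i (s A : R) : 0 < s < 1 ->
  mu.-integrable setT (EFin \o f) -> compactly_supported f ->
  C1 v -> (holder_const (1 - s) v <= 1)%E ->
  (forall N, \sum_(k < N) (2 `^ s) ^+ k *
     \int[mu]_x `|f (x + (- 2 ^- k) *: unit_rV i) - f x| <= A) ->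
  mu.-integrable setT (EFin \o (fun x => f x * 'D_(unit_rV i) (fun y => v y ord0 i) x)) /\
  \int[mu]_x (f x * 'D_(unit_rV i) (fun y => v y ord0 i) x) <= \int[mu]_x `|f x| + A.
Proof.
move=> s01 f1 [K cK Kf] C1v hv HA.
have [r [rreal Hr]] := compact_bounded cK.
(* [K] lies in the ball of radius [r + 1], and the difference quotients look up to distance 1 beyond
   it. *)
have [B HB] := continuous_bounded_ball (r + 2) (@C1_partial_continuous v i C1v).
have fK : {ae mu, forall x, f x != 0 -> `|x| <= r + 1}.
  apply: filterS Kf => x Kx fx0; have [Kx'|/Kx f0] := pselect (K x).
    by apply: Hr => //; rewrite ltrDl.
  by rewrite f0 eqxx in fx0.
have mw' : measurable_fun setT ('D_(unit_rV i) (fun y => v y ord0 i)).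
  by apply: continuous_measurable_fun_rV; exact: C1_partial_continuous.
split.
  apply: (@integrable_mulr_bounded _ _ _ _ _ _ B) => //.
  apply: filterS fK => x xr fx0; apply: HB; rewrite (le_trans (xr fx0))//.
  by rewrite lerD2l ler1n.
have cv := @Rintegral_mulr_cvg _ _ _ mu f (dyadic_quot v i) _ B f1
  (fun k => measurable_dyadic_quot i k C1v) mw'.
have {}cv : \int[mu]_x (f x * dyadic_quot v i k x) @[k --> \oo] -->
  \int[mu]_x (f x * 'D_(unit_rV i) (fun y => v y ord0 i) x).
  apply: cv.
    apply: filterS fK => x xr fx0 k; apply: dyadic_quot_bound => // y yx; apply: HB.
    by have := xr fx0; lra.
  by apply: aeW => x _; exact: dyadic_quot_cvg.
rewrite -(cvg_lim _ cv)//; apply: limr_le; first exact: cvgP cv.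
apply: nearW => N; rewrite (le_trans (Rintegral_dyadic_quot_le i N s01 f1 C1v hv))//.
by rewrite lerD2l.
Qed.

Lemma divergence_mulr_le f v (s A : R) : 0 < s < 1 ->
  mu.-integrable setT (EFin \o f) -> compactly_supported f ->
  C1 v -> (holder_const (1 - s) v <= 1)%E ->
  (forall N i, \sum_(k < N) (2 `^ s) ^+ k *
     \int[mu]_x `|f (x + (- 2 ^- k) *: unit_rV i) - f x| <= A) ->
  (\int[mu]_x (f x * divergence v x)%:E <= (d%:R * (\int[mu]_x `|f x| + A))%:E)%E.
Proof.
move=> s01 f1 fs C1v hv HA.
have H i := partial_mulr_le s01 f1 fs C1v hv (HA ^~ i).
suff [iS SE] : mu.-integrable setT (EFin \o (fun x => f x * divergence v x)) /\
  \int[mu]_x (f x * divergence v x) <= d%:R * (\int[mu]_x `|f x| + A).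
  by rewrite -[leLHS]fineK ?lee_fin//; exact: integrable_fin_num.
pose D i x := f x * 'D_(unit_rV i) (fun y => v y ord0 i) x.
have -> : (fun x => f x * divergence v x) = (fun x => \sum_i D i x).
  by apply/funext => x; rewrite mulr_sumr.
have -> : d%:R * (\int[mu]_x `|f x| + A) = \sum_(i < d) (\int[mu]_x `|f x| + A).
  by rewrite sumr_const card_ord mulr_natl.
elim: (index_enum _) => [|i l [IH1 IH2]].
  rewrite big_nil (_ : (fun x => _) = cst 0); last first.
    by apply/funext => x; rewrite big_nil.
  by split; [exact: integrable0|rewrite Rintegral_cst// mul0r].
rewrite big_cons (_ : (fun x => \sum_(_ <- _) _) =
   (fun x => D i x + \sum_(j <- l) D j x)); last first.
  by apply/funext => x; rewrite big_cons.
have [h1 h2] := H i; split; first exact: integrable_EFinD.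
by rewrite RintegralD// lerD.
Qed.

End forward.

(** * The Gagliardo seminorm and the modulus of translation *)

Section translation_modulus.
Context {R : realType} {d : nat}.
Implicit Types (h x y z : 'rV[R]_d) (i j : 'I_d).
Local Notation mu := (lebesgue_rV R d).
Variable f : 'rV[R]_d -> R.
Hypothesis f1 : mu.-integrable setT (EFin \o f).

Definition translation_l1 h : R := \int[mu]_x `|f (x + h) - f x|.

Let mf : measurable_fun setT f.
Proof. by apply/measurable_EFinP; exact: measurable_int f1. Qed.

Let idiff h : mu.-integrable setT (EFin \o (fun x => f (x + h) - f x)).
Proof. by apply: integrable_EFinB => //; exact: integrable_shift_rV. Qed.

Let iadiff h : mu.-integrable setT (EFin \o (fun x => `|f (x + h) - f x|)).
Proof. exact: integrable_abse (idiff h). Qed.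

Let mdiff h : measurable_fun setT (fun x => `|f (x + h) - f x|).
Proof. by apply/measurable_EFinP; exact: measurable_int (iadiff h). Qed.

Lemma translation_l1_ge0 h : 0 <= translation_l1 h.
Proof. exact: Rintegral_ge0. Qed.

Lemma translation_l1E h : (translation_l1 h)%:E = (\int[mu]_x (`|f (x + h) - f x|)%:E)%E.
Proof. by rewrite /translation_l1 /Rintegral fineK//; exact: integrable_fin_num
    (iadiff h). Qed.

Lemma translation_l1_0 : translation_l1 0 = 0.
Proof.
rewrite /translation_l1 (_ : (fun x => _) = cst 0) ?Rintegral_cst ?mul0r//.
by apply/funext => x; rewrite addr0 subrr normr0.
Qed.

Lemma translation_l1D h z : translation_l1 (h + z) <= translation_l1 h + translation_l1 z.
Proof.
have E : translation_l1 z = \int[mu]_x `|f (x + h + z) - f (x + h)|.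
  exact/esym/(Rintegral_shift_rV h (mdiff z)).
have i2 := integrable_shift_rV h (iadiff z).
rewrite E /translation_l1 -RintegralD//; apply: le_Rintegral => //.
  exact: integrable_EFinD.
by move=> x _; rewrite addrA [leRHS]addrC ler_distD.
Qed.

Lemma translation_l1N h : translation_l1 (- h) = translation_l1 h.
Proof.
rewrite /translation_l1; have /esym E := Rintegral_shift_rV h (mdiff (- h)).
by rewrite [LHS]E; apply: eq_Rintegral => x _; rewrite addrK distrC.
Qed.

Lemma translation_l1_le_norm1 h : translation_l1 h <= 2 * \int[mu]_x `|f x|.
Proof.
have i1 : mu.-integrable setT (EFin \o (fun x => `|f x|)) by exact: integrable_abse f1.
have m1 : measurable_fun setT (fun x => `|f x|) by exact: measurableT_comp.
rewrite mulr_natl mulr2n -[X in _ <= X + _](Rintegral_shift_rV h m1).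
rewrite -RintegralD//; last exact: (integrable_shift_rV h i1).
apply: le_Rintegral => //.
  by apply: integrable_EFinD => //; exact: (integrable_shift_rV h i1).
by move=> x _; exact: ler_normB.
Qed.

Lemma translation_l1_le_sum h : translation_l1 h <= \sum_i translation_l1 (h ord0 i
    *: unit_rV i).
Proof.
rewrite {1}(row_sum_delta h); elim: (index_enum _) => [|i l IH].
  by rewrite !big_nil translation_l1_0.
by rewrite !big_cons (le_trans (translation_l1D _ _))// lerD2l.
Qed.

Lemma measurable_enorm n : measurable_fun setT (@enorm R n).
Proof.
have ms : measurable_fun setT (fun x : 'rV[R]_n => \sum_(i < n) x ord0 i ^+ 2).
  by apply: measurable_sum => i; apply: measurable_funX; exact: measurable_coord.
apply: (measurableT_comp _ ms); apply: continuous_measurable_fun.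
exact: sqrt_continuous.
Qed.

Let kernel (p : R) (yh : 'rV[R]_d * 'rV[R]_d) : \bar R :=
  (`|f (yh.1 + yh.2) - f yh.1| / enorm yh.2 `^ p)%:E.

Let measurable_kernel p : measurable_fun setT (kernel p).
Proof.
have m1 : measurable_fun setT (fun yh : 'rV[R]_d * 'rV[R]_d => yh.1 + yh.2).
  apply: measurable_fun_rV => i; under eq_fun do rewrite mxE.
  apply: measurable_funD.
    by apply: (@measurableT_comp _ _ _ _ _ _ (fun x : 'rV[R]_d => x ord0 i) _ fst);
        [exact: measurable_coord|exact: measurable_fst].
  by apply: (@measurableT_comp _ _ _ _ _ _ (fun x : 'rV[R]_d => x ord0 i) _ snd);
      [exact: measurable_coord|exact: measurable_snd].
apply/measurable_EFinP; apply: measurable_funM.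
  apply: measurableT_comp => //; apply: measurable_funB.
    exact: measurableT_comp mf m1.
  by apply: measurableT_comp mf _; exact: measurable_fst.
under eq_fun do rewrite -powRN.
apply: (@measurableT_comp _ _ _ _ _ _ (fun r : R => r `^ (- p)) _ (fun yh : 'rV[R]_d
    * 'rV[R]_d => enorm yh.2)); first exact: measurable_powR.
by apply: (@measurableT_comp _ _ _ _ _ _ (@enorm R d) _ snd); [exact:
    measurable_enorm|exact: measurable_snd].
Qed.

Let kernel_ge0 p yh : (0 <= kernel p yh)%E.
Proof. by rewrite lee_fin divr_ge0// powR_ge0. Qed.

Let kernelE p h : (\int[mu]_y kernel p (y, h) = (translation_l1 h / enorm h `^ p)%:E)%E.
Proof.
rewrite EFinM translation_l1E -ge0_integralZr//; last by rewrite lee_fin invr_ge0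
    powR_ge0.
by apply/measurable_EFinP; exact: mdiff.
Qed.

Lemma measurable_translation_l1_kernel p :
  measurable_fun setT (fun h => (translation_l1 h / enorm h `^ p)%:E).
Proof.
have := @measurable_fun_fubini_tonelli_G _ _ _ _ _ mu _ (measurable_kernel p)
    (kernel_ge0 p).
by congr measurable_fun; apply/funext => h; exact: kernelE.
Qed.

Lemma Ws1_seminormE (s : R) :
  Ws1_seminorm s f = (\int[mu]_h (translation_l1 h / enorm h `^ (d%:R + s))%:E)%E.
Proof.
transitivity (\int[mu]_y \int[mu]_h kernel (d%:R + s) (y, h))%E; last first.
  by rewrite fubini_tonelli//; apply: eq_integral => h _; exact: kernelE.
apply: eq_integral => y _.
pose F x := (`|f x - f y| / enorm (x - y) `^ (d%:R + s))%:E.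
have mF : measurable_fun setT F.
  apply/measurable_EFinP; apply: measurable_funM.
    by apply: measurableT_comp => //; exact: measurable_funB.
  under eq_fun do rewrite -powRN.
  apply: (@measurableT_comp _ _ _ _ _ _ (fun r : R => r `^ (- (d%:R + s))) _
    (fun x => enorm (x - y))); first exact: measurable_powR.
  by apply: measurable_shift_rV; exact: measurable_enorm.
have F0 x : (0 <= F x)%E by rewrite lee_fin divr_ge0// powR_ge0.
transitivity (\int[mu]_x F x)%E; first exact: erefl.
transitivity (\int[mu]_x F (x + y)%R)%E.
  exact: esym (ge0_integral_shift_rV y mF F0).
by apply: eq_integral => h _; rewrite /F /kernel/= addrK (addrC y).
Qed.

(** With exponent 0 the weight is identically 1, so measurability in [h] is that of a partial
    integral in Tonelli's theorem. *)
Lemma measurable_translation_l1 : measurable_fun setT translation_l1.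
Proof.
apply/measurable_EFinP; have := measurable_translation_l1_kernel 0.
by congr measurable_fun; apply/funext => h /=; rewrite powRr0 divr1.
Qed.

Definition cube (a b : R) := [set x : 'rV[R]_d | forall i, `[a, b[%classic (x ord0 i)].

Lemma measurable_cube a b : measurable (cube a b).
Proof.
rewrite /cube (_ : mkset _ = \bigcap_(i in [set: 'I_d])
  ([set: 'rV[R]_d] `&` (fun y : 'rV[R]_d => y ord0 i) @^-1` `[a, b[)).
  by apply: fin_bigcap_measurable => // i _; exact: measurable_coord.
apply/seteqP; split => y Hy i; first by split => //; exact: Hy.
by case: (Hy i Logic.I).
Qed.

Lemma lebesgue_cube (a b : R) : a <= b -> mu (cube a b) = ((b - a) ^+ d)%:E.
Proof.
move=> ab; rewrite /cube (lebesgue_rV_box (A := fun=> `[a, b[%classic))//.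
rewrite (eq_bigr (fun=> (b - a)%:E)) => [|i _].
  by rewrite prodEFin prodr_const card_ord.
rewrite lebesgue_measure_itv/= lte_fin; case: ltP => [_|ba]; first by rewrite EFinB.
by rewrite (@le_anti _ _ a b) ?subrr// ab.
Qed.

End translation_modulus.

(** * Dyadic sums controlled by the seminorm *)

Section seminorm_dyadic.
Context {R : realType} {d : nat}.
Implicit Types (h x y z : 'rV[R]_d) (i j : 'I_d).
Local Notation mu := (lebesgue_rV R d).
Variable f : 'rV[R]_d -> R.
Hypothesis f1 : mu.-integrable setT (EFin \o f).
Variable s : R.
Hypotheses (s0 : 0 < s) (s1 : s < 1).

Local Notation q := (2 `^ s).
Local Notation p := (d%:R + s).
Local Notation Phi h := (translation_l1 f h / enorm h `^ p)%:E.

Let mtmod : measurable_fun setT (fun h => (translation_l1 f h)%:E).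
Proof. by apply/measurable_EFinP; exact: measurable_translation_l1. Qed.

Let mPhi : measurable_fun setT (fun h => Phi h).
Proof. exact: measurable_translation_l1_kernel. Qed.

Let Phi_ge0 h : (0 <= Phi h)%E.
Proof. by rewrite lee_fin divr_ge0 ?powR_ge0 ?translation_l1_ge0. Qed.

(* Average [g h <= g w + g (w - h)] over [w] in the cube [3 c, 4 c[^d. *)
Lemma translation_l1_cube i (c : R) : 0 < c ->
  ((translation_l1 f (c *: unit_rV i) * c ^+ d)%:E <=
    2%:E * \int[mu]_(w in cube (2 * c) (4 * c)) (translation_l1 f w)%:E)%E.
Proof.
move=> c0; set h := c *: unit_rV i; set B := cube _ _; pose C := cube (d := d) (3 *
    c) (4 * c).
have mC : measurable C by exact: measurable_cube.
have mB : measurable B by exact: measurable_cube.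
have CB : C `<=` B.
  by move=> w Cw j; have := Cw j; rewrite /= !in_itv/= => /andP[? ?]; apply/andP;
      split; lra.
have CBh w : C w -> B (w - h).
  move=> Cw j; have := Cw j; rewrite /= !in_itv/= !mxE eqxx/= => /andP[? ?].
  by case: eqP => _ /=; rewrite ?mulr1 ?mulr0; apply/andP; split; lra.
have muC : mu C = (c ^+ d)%:E.
  rewrite lebesgue_cube; last lra.
  by congr ((_ ^+ _)%:E); lra.
rewrite EFinM -muC -(integral_cst _ mC).
have mh : measurable_fun setT (fun w : 'rV[R]_d => (translation_l1 f (w - h))%:E).
  exact: (measurable_shift_rV (- h) mtmod).
apply: (@le_trans _ _ (\int[mu]_(w in C) ((translation_l1 f w)%:E + (translation_l1 f
    (w - h))%:E))%E).
  apply: ge0_le_integral => //.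
  - by move=> x _; rewrite lee_fin translation_l1_ge0.
  - by apply: measurable_funTS; exact: emeasurable_funD.
  move=> w _; rewrite -EFinD lee_fin -[h in leLHS](subrK w) -opprB.
  by rewrite addrC (le_trans (translation_l1D f1 _ _))// translation_l1N.
rewrite ge0_integralD//; try (by move=> w _; rewrite lee_fin translation_l1_ge0); try
    exact: measurable_funTS.
rewrite mule_natl mule2n; apply: leeD.
  apply: ge0_subset_integral => //; first exact: measurable_funTS.
  by move=> w _; rewrite lee_fin translation_l1_ge0.
rewrite integral_mkcond [leRHS]integral_mkcond.
have mg : measurable_fun setT ((fun w => (translation_l1 f w)%:E) \_ B).
  by apply/(measurable_restrictT _ mB); exact: measurable_funTS.
rewrite -(ge0_integral_shift_rV (- h) mg); last first.
  by move=> x; apply: erestrict_ge0 => w _; rewrite lee_fin translation_l1_ge0.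
apply: ge0_le_integral => //.
- by move=> x _; apply: erestrict_ge0 => w _; rewrite lee_fin translation_l1_ge0.
- by apply/(measurable_restrictT _ mC); exact: measurable_funTS.
- exact: (measurable_shift_rV (- h) mg).
move=> w _; rewrite !patchE; case: ifPn => [/set_mem/CBh/mem_set -> //|_].
by case: ifP => // _; rewrite lee_fin translation_l1_ge0.
Qed.

Lemma powR_pow2 k : (2 ^- k) `^ p = (2 ^- k) ^+ d / q ^+ k.
Proof.
rewrite powRD; last by rewrite invr_eq0 expf_eq0 pnatr_eq0 andbF implybT.
rewrite powR_mulrn ?invr_ge0 ?exprn_ge0//; congr (_ * _).
by rewrite -(powR_invn k (ler0n R 2)) -powRrM mulNr powRN mulrC powRrM powR_mulrn
    ?powR_ge0.
Qed.

(** On the cube [enorm w <= 4 * d * c] with [c = 2^-k], so inserting the weight costs [(4 * d * c)]^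
    p[. Since]c [^ p = c ^+ d / q ^+ k], this cancels the volume [c ^+ d] and leaves the factor
    [q ^+ k]. *)
Lemma translation_l1_shell_le i k :
  ((q ^+ k * translation_l1 f (2 ^- k *: unit_rV i))%:E <=
   (2 * (4 * d%:R) `^ p)%:E *
     \int[mu]_(w in cube (2 * 2 ^- k) (4 * 2 ^- k)) Phi w)%E.
Proof.
set c : R := 2 ^- k; have c0 : 0 < c by rewrite invr_gt0 exprn_gt0.
set B := cube _ _; have mB : measurable B by exact: measurable_cube.
have q0 : 0 < q by rewrite powR_gt0.
have cp : c `^ p = c ^+ d / q ^+ k by exact: powR_pow2.
have d0 : 0 < d%:R :> R by rewrite ltr0n (leq_ltn_trans _ (ltn_ord i)).
have H : (\int[mu]_(w in B) (translation_l1 f w)%:E <=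
    ((4 * d%:R) `^ p * c `^ p)%:E * \int[mu]_(w in B) Phi w)%E.
  rewrite -ge0_integralZl//; last 2 first.
  - exact: measurable_funTS.
  - by rewrite lee_fin mulr_ge0// powR_ge0.
  apply: ge0_le_integral => //.
  - by move=> w _; rewrite lee_fin translation_l1_ge0.
  - exact: measurable_funTS.
  - by apply: measurable_funeM; exact: measurable_funTS.
  move=> w Bw; rewrite -EFinM lee_fin mulrCA -[leLHS]mulr1.
  apply: ler_wpM2l; first exact: translation_l1_ge0.
  have wi := Bw i; rewrite /= in_itv/= in wi; case/andP: wi => wi _.
  have wpos : 0 < enorm w.
    apply: enorm_gt0; apply/eqP => w0; move: wi; rewrite w0 mxE leNgt.
    by rewrite mulr_gt0.
  rewrite ler_pdivlMr ?powR_gt0// mul1r -powRM ?mulr_ge0 ?(ltW c0)//.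
  apply: ge0_ler_powR; rewrite ?nnegrE ?enorm_ge0 ?mulr_ge0 ?(ltW c0)//.
    by rewrite addr_ge0// ltW.
  apply: (le_trans (enorm_le_norm _)); rewrite -mulrA mulrCA ler_wpM2l//.
  rewrite rV_norm_le ?mulr_ge0 ?(ltW c0)//; apply/forallP => j.
  have := Bw j; rewrite /= in_itv/= => /andP[h1 h2].
  by rewrite ger0_norm ?(ltW h2)//; lra.
have := translation_l1_cube i c0; rewrite -/B.
move=> /le_trans/(_ (lee_wpmul2l _ H)) H2.
have h20 : (0 <= 2%:E :> \bar R)%E by rewrite lee_fin.
have {}H2 := H2 h20.
have cd : 0 < c ^+ d by rewrite exprn_gt0.
have E : (q ^+ k * translation_l1 f (c *: unit_rV i))%:E =
  ((q ^+ k / c ^+ d)%:E * (translation_l1 f (c *: unit_rV i) * c ^+ d)%:E)%E.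
  by rewrite -EFinM; congr EFin; field; rewrite gt_eqF.
rewrite E; apply: (le_trans (lee_wpmul2l _ H2)).
  by rewrite lee_fin divr_ge0 ?exprn_ge0 ?ltW.
rewrite !muleA -!EFinM le_eqVlt; apply/orP; left; apply/eqP; congr (_%:E * _)%E.
rewrite cp; field; rewrite !gt_eqF// exprn_gt0//.
Qed.

Lemma dyadic_le_seminorm : (Ws1_seminorm s f < +oo)%E ->
  exists A, forall N i, \sum_(k < N) q ^+ k * translation_l1 f ((- 2 ^- k) *: unit_rV
      i) <= A.
Proof.
move=> Woo; have Wpos : (0 <= Ws1_seminorm s f)%E.
  by rewrite (Ws1_seminormE f1) integral_ge0.
have Wfin : Ws1_seminorm s f \is a fin_num by rewrite ge0_fin_numE.
exists (2 * (4 * d%:R) `^ p * fine (Ws1_seminorm s f)) => N i.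
rewrite -lee_fin EFinM fineK// -sumEFin.
pose B k := cube (R := R) (d := d) (2 * 2 ^- k) (4 * 2 ^- k).
have mB k : measurable (B k) by exact: measurable_cube.
apply: (@le_trans _ _ (\sum_(k < N) (2 * (4 * d%:R) `^ p)%:E * \int[mu]_(w in B k)
    Phi w)%E).
  by apply: lee_sum => k _; rewrite scaleNr translation_l1N//; exact:
      translation_l1_shell_le.
rewrite -ge0_sume_distrr; last by move=> k _; exact: integral_ge0.
rewrite lee_wpmul2l ?lee_fin ?mulr_ge0 ?powR_ge0// (Ws1_seminormE f1).
rewrite -(big_mkord xpredT (fun k => \int[mu]_(w in B k) Phi w)%E).
rewrite -ge0_integral_bigsetU//=.
- apply: ge0_subset_integral => //.
  exact: bigsetU_measurable.
- exact: iota_uniq.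
- apply/trivIsetP => k l _ _; wlog kl : k l / (k < l)%N.
    move=> hw; case: (ltngtP k l) => [kl|lk|//] _.
      by apply: hw => //; rewrite neq_ltn kl.
    by rewrite setIC; apply: hw => //; rewrite neq_ltn lk.
  (* One coordinate separates the cubes: for [k < l] the upper end [4 * 2^-l] is at most the lower
     end [2 * 2^-k]. *)
  move=> _; apply/seteqP; split => // w [/(_ i) + /(_ i)].
  rewrite /= !in_itv/= => /andP[h1 _] /andP[_ h2].
  have : 2 ^- l * 2 <= 2 ^- k :> R.
    rewrite -ler_pdivlMr// -invfM -exprSr lef_pV2 ?posrE ?exprn_gt0//.
    by rewrite ler_weXn2l// ler1n.
  lra.
- exact: measurable_funTS.
Qed.

End seminorm_dyadic.

(** * The seminorm controlled by dyadic sums *)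

Section cover_bound.
Context {disp : measure_display} {T : measurableType disp} {R : realType}.
Variable mu : {measure set T -> \bar R}.

(** On [D] the integrand lies below the series of the [a k] times the indicators of the [Q k]. The
    [Q k] may overlap and the bound on [Phi x] is needed for one [k] only, so shells can be replaced
    by the cubes containing them. *)
Lemma integral_le_cover (D : set T) (Phi : T -> \bar R) (Q : nat -> set T)
    (a : nat -> R) (A : R) :
  measurable D -> measurable_fun setT Phi -> (forall x, 0 <= Phi x)%E ->
  (forall k, measurable (Q k)) -> (forall k, 0 <= a k) ->
  (forall x, D x -> exists k, Q k x /\ (Phi x <= (a k)%:E)%E) ->
  (forall N, \sum_(k < N) (a k)%:E * mu (Q k) <= A%:E)%E ->
  (\int[mu]_(x in D) Phi x <= A%:E)%E.
Proof.
move=> mD mPhi Phi0 mQ a0 cov HA.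
pose g k x : \bar R := ((a k)%:E * (\1_(Q k) x)%:E)%E.
have g0 k x : (0 <= g k x)%E by rewrite mule_ge0 ?lee_fin.
have mg k : measurable_fun setT (g k).
  by apply: measurable_funeM; apply/measurable_EFinP.
apply: (@le_trans _ _ (\int[mu]_(x in D) \sum_(0 <= k <oo) g k x)%E).
  apply: ge0_le_integral => //.
  - exact: measurable_funTS.
  - by apply: ge0_emeasurable_sum => // k _; exact: measurable_funTS.
  move=> x Dx; have [k [Qk Pk]] := cov x Dx.
  apply: (le_trans Pk); apply: (le_trans _ (nneseries_lim_ge k.+1 _)) => //.
  rewrite big_nat_recr//= -[leLHS]add0e leeD ?sume_ge0//.
  by rewrite /g indicE mem_set// mule1.
apply: (@le_trans _ _ (\int[mu]_x \sum_(0 <= k <oo) g k x)%E).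
  apply: ge0_subset_integral => //.
    by apply: ge0_emeasurable_sum.
  by move=> x _; exact: nneseries_ge0.
rewrite integral_nneseries//.
apply: lime_le; first by apply: is_cvg_nneseries => k _ _; exact: integral_ge0.
apply: nearW => N; rewrite big_mkord (le_trans _ (HA N))//.
apply: lee_sum => k _; rewrite /g ge0_integralZl//; last 2 first.
- by apply/measurable_EFinP.
- by rewrite lee_fin.
by rewrite integral_indic// setIT.
Qed.

End cover_bound.

Section dyadic_seminorm.
Context {R : realType} {d : nat}.
Implicit Types (h x y z : 'rV[R]_d) (i j : 'I_d).
Local Notation mu := (lebesgue_rV R d).
Variable f : 'rV[R]_d -> R.
Hypothesis f1 : mu.-integrable setT (EFin \o f).
Variable s : R.
Hypotheses (s0 : 0 < s) (s1 : s < 1).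

Local Notation q := (2 `^ s).
Local Notation p := (d%:R + s).
Local Notation Phi h := (translation_l1 f h / enorm h `^ p)%:E.
Local Notation B1 := [set h : 'rV[R]_d | (`|h| <= 1)%R].

Lemma exists_pow2_ge (r : R) : exists n, r <= 2 ^+ n.
Proof.
exists (Num.truncn r).+1; apply/ltW/(lt_le_trans (truncnS_gt r)).
by rewrite -natrX ler_nat ltnW// ltn_expl.
Qed.

Lemma exists_dyadic_le1 (r : R) : 0 < r <= 1 ->
  exists k, 2 ^- k.+1 < r <= 2 ^- k.
Proof.
move=> /andP[r0 r1].
have ex : exists n, 2 ^- n < r.
  have [n rn] := exists_pow2_ge r^-1; exists n.+1.
  rewrite -[ltRHS]invrK ltf_pV2 ?posrE ?invr_gt0 ?exprn_gt0//.
  by rewrite (le_lt_trans rn)// ltr_eXn2l// ltr1n.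
case: (ex_minnP ex) => -[|k] nk min_k; first by move: nk; rewrite expr0 invr1 ltNge r1.
exists k; rewrite nk leNgt/=; apply/negP => /min_k.
by rewrite ltnn.
Qed.

Lemma exists_dyadic_ge1 (r : R) : 1 < r -> exists k, 2 ^+ k < r <= 2 ^+ k.+1.
Proof.
move=> r1; have ex := exists_pow2_ge r.
case: (ex_minnP ex) => -[|k] nk min_k; first by move: nk; rewrite expr0 leNgt r1.
exists k; rewrite nk andbT ltNge; apply/negP => /min_k.
by rewrite ltnn.
Qed.

(** Half of a positive supremum is always reached, whether or not the supremum is attained; if the
    supremum is not positive, the point [0] does. *)
Lemma exists_half_sup (P : set R) (g : R -> R) (M : R) : (forall t, 0 <= g t <= M) ->
  P 0 -> exists2 T, P T & forall t, P t -> g t <= 2 * g T.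
Proof.
move=> gM P0; have hs : has_sup (g @` P).
  split; first by exists (g 0); exists 0.
  by exists M => _ [t _ <-]; case/andP: (gM t).
have ub t : P t -> g t <= sup (g @` P).
  by move=> Pt; apply: (ub_le_sup hs.2); exists t.
have [S0|S0] := leP (sup (g @` P)) 0.
  exists 0 => // t /ub tS; rewrite (le_trans tS)// (le_trans S0)// mulr_ge0//.
  by case/andP: (gM 0).
have [|_ [T PT <-] HT] := @sup_adherent _ _ (sup (g @` P) / 2) _ hs.
  by rewrite divr_gt0.
by exists T => // t /ub; lra.
Qed.

Let mPhi : measurable_fun setT (fun h => Phi h).
Proof. exact: measurable_translation_l1_kernel. Qed.

Let Phi_ge0 h : (0 <= Phi h)%E.
Proof. by rewrite lee_fin divr_ge0 ?powR_ge0 ?translation_l1_ge0. Qed.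

Let unit_ball_measurable : measurable B1.
Proof.
rewrite (_ : mkset _ = \bigcap_(i in [set: 'I_d])
  ([set: 'rV[R]_d] `&` (fun y : 'rV[R]_d => y ord0 i) @^-1` `[-1, 1])).
  by apply: fin_bigcap_measurable => // i _; exact: measurable_coord.
apply/seteqP; split => y /=; rewrite rV_norm_le//.
  by move=> /forallP Hy i _; split => //; rewrite /= in_itv/= -ler_norml.
move=> Hy; apply/forallP => i; have [_] := Hy i Logic.I.
by rewrite /= in_itv/= -ler_norml.
Qed.

Let p_ge0 : 0 <= p. Proof. by rewrite addr_ge0// ltW. Qed.

(** The upper end is [2 * c] since the cubes are half-open and must contain points with a coordinate
    equal to [c]. *)
Let norm_cube (c : R) h : 0 < c -> `|h| <= c -> cube (- c) (2 * c) h.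
Proof.
move=> c0; rewrite rV_norm_le ?ltW// => /forallP H i.
rewrite /= in_itv/=; have := H i; rewrite ler_norml => /andP[? ?].
by apply/andP; split; lra.
Qed.

Let Phi_le (b r : R) h : 0 <= b -> 0 < r -> r < `|h| -> translation_l1 f h <= b ->
  translation_l1 f h / enorm h `^ p <= b / r `^ p.
Proof.
move=> b0 r0 rh tb; apply: ler_pM => //; first exact: translation_l1_ge0.
  by rewrite invr_ge0 powR_ge0.
have eh : r <= enorm h by rewrite (le_trans (ltW rh))// norm_le_enorm.
rewrite lef_pV2 ?posrE ?powR_gt0//; last exact: lt_le_trans eh.
by apply: ge0_ler_powR; rewrite ?nnegrE ?enorm_ge0 ?(ltW r0).
Qed.

Lemma inner_integral_lty (C : R) : (forall N i (t : nat -> R), (forall k, `|t k| <= 2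
    ^- k) ->
    \sum_(k < N) q ^+ k * translation_l1 f (t k *: unit_rV i) <= C) ->
  (\int[mu]_(h in B1) Phi h <= (2 * q * 6 ^+ d * (d%:R * C))%:E)%E.
Proof.
move=> HC; have q0 : 0 < q by rewrite powR_gt0.
(* [T (k, i)] is a nearly worst translation of size at most [2^-k] along axis [i]; for fixed [i]
   these form the sequence to which the hypothesis is applied. *)
have /choice[T TP] : forall ki : nat * 'I_d, exists T : R, `|T| <= 2 ^- ki.1 /\
    forall t, `|t| <= 2 ^- ki.1 -> translation_l1 f (t *: unit_rV ki.2) <= 2 *
        translation_l1 f (T *: unit_rV ki.2).
  move=> [k i]; have [||T PT HT] := @exists_half_sup [set t | `|t| <= 2 ^- k]
    (fun t => translation_l1 f (t *: unit_rV i)) (2 * \int[mu]_x `|f x|).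
  - by move=> t; rewrite translation_l1_ge0 translation_l1_le_norm1.
  - by rewrite /= normr0 invr_ge0 exprn_ge0.
  by exists T.
pose G k := \sum_i 2 * translation_l1 f (T (k, i) *: unit_rV i).
have G0 k : 0 <= G k by apply: sumr_ge0 => i _; rewrite mulr_ge0// translation_l1_ge0.
(* On the shell [2^-(k+1) < |h| <= 2^-k] the numerator is at most [G k], by splitting [h] along the
   axes, and the weight is largest at the inner radius. *)
pose a k := G k / (2 ^- k.+1) `^ p.
have a0 k : 0 <= a k by rewrite divr_ge0// powR_ge0.
apply: (@integral_le_cover _ _ _ mu _ _ (fun k => cube (- (2 ^- k)) (2 * 2 ^- k)) a)
    => //.
- by move=> k; exact: measurable_cube.
- move=> h /= h1; have [->|h0] := eqVneq h 0.
    (* At [h = 0] the numerator, hence the integrand, is 0, so any cube around the origin will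
       do. *)
    exists 0%N; split; first by apply: norm_cube; rewrite ?normr0// expr0 invr1.
    by rewrite (translation_l1_0 f) mul0r lee_fin.
  have [|k /andP[k1 k2]] := @exists_dyadic_le1 `|h|.
    by rewrite normr_gt0 h0.
  have pos n : 0 < 2 ^- n :> R by rewrite invr_gt0 exprn_gt0.
  exists k; split; first exact: norm_cube.
  rewrite lee_fin; apply: Phi_le => //.
  rewrite (le_trans (translation_l1_le_sum f1 h))//; apply: ler_sum => i _.
  have [_] := TP (k, i); apply; exact: le_trans (coord_le_norm h i) k2.
- move=> N; have E k : ((a k)%:E * mu (cube (- 2 ^- k) (2 * 2 ^- k)) =
      (\sum_i 2 * q * 6 ^+ d * (q ^+ k * translation_l1 f (T (k, i) *: unit_rV i)))%:E)%E.
    rewrite lebesgue_cube; last first.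
      have : 0 <= 2 ^- k :> R by rewrite invr_ge0 exprn_ge0.
      lra.
    rewrite -EFinM; congr EFin; rewrite /a powR_pow2 /G.
    have c0 : 0 < 2 ^- k.+1 :> R by rewrite invr_gt0 exprn_gt0.
    (* Written this way the volume cancels [(2^-(k+1)) ^+ d] in the weight up to [6 ^+ d]; what
       remains is [q ^+ k.+1], the origin of the extra factor [q]. *)
    have -> : 2 * 2 ^- k - - 2 ^- k = 6 * 2 ^- k.+1 :> R.
      by rewrite exprS; field; rewrite expf_neq0// pnatr_eq0.
    rewrite exprMn -mulr_sumr; set S := \sum_i translation_l1 f _.
    under eq_bigr do rewrite mulrA.
    rewrite -mulr_sumr -/S (exprS q); field.
    by rewrite !expf_neq0// ?gt_eqF// exprn_gt0.
  under eq_bigr do rewrite E.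
  rewrite sumEFin lee_fin exchange_big/=.
  have -> : 2 * q * 6 ^+ d * (d%:R * C) = \sum_(i < d) 2 * q * 6 ^+ d * C.
    by rewrite sumr_const card_ord -mulr_natl; ring.
  apply: ler_sum => i _; rewrite -mulr_sumr ler_wpM2l//.
  by apply: (HC N i (fun k => T (k, i))) => k; case: (TP (k, i)).
Qed.

(** Far from the origin twice the norm of [f] bounds the numerator. A shell of radius about [2^k]
    has volume of order [2^(kd)] against the weight [2^(k(d+s))], so a geometric series of ratio
    [q^-1] remains. *)
Lemma outer_integral_lty :
  (\int[mu]_(h in ~` B1) Phi h <=
    (2 * (\int[mu]_x `|f x|) * 6 ^+ d / (1 - q^-1))%:E)%E.
Proof.
have q1 : 1 < q := powR2_gt1 s0.
have q0 : 0 < q by rewrite powR_gt0.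
set M := 2 * \int[mu]_x `|f x|.
have M0 : 0 <= M by rewrite mulr_ge0// Rintegral_ge0.
pose a k := M / (2 ^+ k) `^ p.
have a0 k : 0 <= a k by rewrite divr_ge0// powR_ge0.
have pow2 k : (2 ^+ k) `^ p = (2 ^+ k) ^+ d * q ^+ k :> R.
  rewrite powRD; last by rewrite expf_eq0 pnatr_eq0 andbF implybT.
  rewrite powR_mulrn ?exprn_ge0//; congr (_ * _).
  by rewrite -powR_mulrn// -powRrM mulrC powRrM powR_mulrn ?powR_ge0.
apply: (@integral_le_cover _ _ _ mu _ _ (fun k => cube (- (2 ^+ k.+1)) (2 * 2 ^+
    k.+1)) a) => //.
- exact: measurableC.
- by move=> k; exact: measurable_cube.
- move=> h /= /negP; rewrite -ltNge => h1.
  have [k /andP[k1 k2]] := exists_dyadic_ge1 h1.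
  exists k; split; first exact: norm_cube.
  rewrite lee_fin; apply: Phi_le => //.
  exact: translation_l1_le_norm1.
- move=> N; have E k : ((a k)%:E * mu (cube (- 2 ^+ k.+1) (2 * 2 ^+ k.+1)) =
      (M * 6 ^+ d * q^-1 ^+ k)%:E)%E.
    rewrite lebesgue_cube; last first.
      have : 0 <= 2 ^+ k.+1 :> R by rewrite exprn_ge0.
      lra.
    rewrite -EFinM; congr EFin; rewrite /a pow2.
    have -> : 2 * 2 ^+ k.+1 - - 2 ^+ k.+1 = 6 * 2 ^+ k :> R.
      by rewrite exprS; ring.
    rewrite exprMn exprVn; field.
    by rewrite !expf_neq0// ?gt_eqF// exprn_gt0.
  under eq_bigr do rewrite E.
  have MK : 0 <= M * 6 ^+ d by apply: mulr_ge0 => //; exact: exprn_ge0.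
  rewrite sumEFin lee_fin -mulr_sumr ler_wpM2l//.
  have r1 : 0 < 1 - q^-1 by rewrite subr_gt0 invf_lt1.
  rewrite -(@ler_pM2l _ (1 - q^-1))// mulfV ?gt_eqF//.
  by rewrite -opprB mulNr -subrX1 opprB gerBl exprn_ge0// invr_ge0 ltW.
Qed.

Lemma seminorm_lty_of_dyadic (C : R) : (forall N i (t : nat -> R), (forall k, `|t k|
    <= 2 ^- k) ->
    \sum_(k < N) q ^+ k * translation_l1 f (t k *: unit_rV i) <= C) ->
  (Ws1_seminorm s f < +oo)%E.
Proof.
move=> HC; rewrite (Ws1_seminormE f1).
rewrite -(setvU B1).
have -> : (\int[mu]_(h in ~` B1 `|` B1) Phi h =
    \int[mu]_(h in ~` B1) Phi h + \int[mu]_(h in B1) Phi h)%E.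
  apply: ge0_integral_setU => //.
  - exact: measurableC.
  - exact: measurable_funTS.
  - by rewrite disj_set2E setICl.
apply: lte_add_pinfty.
  exact: le_lt_trans outer_integral_lty (ltry _).
exact: le_lt_trans (inner_integral_lty HC) (ltry _).
Qed.

End dyadic_seminorm.

Theorem mainTheorem10 (R : realType) (d : nat) (s : R) (f : 'rV[R]_d -> R)
    (d_ge1 : (1 <= d)%N) (s_gt0 : 0 < s) (s_lt1 : s < 1)
    (f_L1 : (lebesgue_rV R d).-integrable [set: 'rV[R]_d] (EFin \o f))
    (f_supp : compactly_supported f) :
  Ws1c s f <->
  (ereal_sup [set \int[lebesgue_rV R d]_x (f x * divergence v x)%:E
             | v in [set v : 'rV[R]_d -> 'rV[R]_d |
                      C1 v /\ holder_const (1 - s)%R v <= 1]] < +oo)%E.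
Proof.
split=> [[_ _ Woo]|].
  have [A HA] := dyadic_le_seminorm f_L1 s_gt0 Woo.
  apply: (@le_lt_trans _ _
    (d%:R * (\int[lebesgue_rV R d]_x `|f x| + A))%:E); last exact: ltry.
  apply: ge_ereal_sup => _ [v [C1v hv] <-].
  apply: divergence_mulr_le f_L1 f_supp C1v hv _; first by rewrite s_gt0.
  exact: HA.
set S := ereal_sup _ => Soo.
have s10 : 0 <= 1 - s by rewrite subr_ge0 ltW.
(* A field with zero divergence is admissible, so [S] is not [-oo]; nonnegativity is used again
   below for a default value. *)
have S0 : (0 <= S)%E.
  have [v [C1v hv v0]] : exists v : 'rV[R]_d -> 'rV[R]_d,
      [/\ C1 v, (holder_const (1 - s) v <= 1)%E & divergence v = cst 0].
    apply: modulus_field_admissible => //; apply: modulus_fieldW modulus_field0 => rho _.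
    by rewrite mulr_ge0 ?invr_ge0 ?powR_ge0.
  apply: ereal_sup_ubound; exists v; first by split.
  by rewrite v0 (eq_integral (cst 0%E)) ?integral0// => x _; rewrite mulr0.
have Sfin : S \is a fin_num by rewrite ge0_fin_numE.
have [v C1v hv|C HC] := @sum_diff_le_dual R d s s_gt0 s_lt1 d_ge1 f (fine S) f_L1.
  have : (\int[lebesgue_rV R d]_x (f x * divergence v x)%:E <= S)%E.
    by apply: ereal_sup_ubound; exists v.
  (* The real-valued integral is 0 by default when the extended one is infinite: [+oo] contradicts
     the finiteness of [S], and for [-oo] the claim becomes [0 <= fine S]. *)
  rewrite /Rintegral; case: (integral _ _ _) => [r| |] /=.
  - by rewrite -{1}(fineK Sfin) lee_fin.
  - by rewrite leye_eq => /eqP Sy; rewrite Sy in Soo.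
  - by rewrite fine_ge0.
by split => //; exact: seminorm_lty_of_dyadic HC.
Qed.
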